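(* Let $\mathfrak{L}=H\oplus\bigoplus_{\alpha\in\Lambda}\mathfrak{L}_\alpha$ be a split Leibniz superalgebra of maximal length over a field $\mathbb{K}$. Suppose that $H=\sum_{\beta\in\Lambda}[\mathfrak{L}_\beta,\mathfrak{L}_{-\beta}]$, that $\mathcal{Z}_{Lie}(\mathfrak{L})=0$, that $\mathfrak{L}$ is root-multiplicative, and that $|\Lambda^{\neg\mathfrak{I}}|>2$ and $|\Lambda^{\mathfrak{I}}|>2$. Then $\mathfrak{L}$ is simple if and only if $\Lambda^{\mathfrak{I}}$ and $\Lambda^{\neg\mathfrak{I}}$ have (respectively) all of their elements $\neg\mathfrak{I}$-connected.
   Context: Let $\mathbb{K}$ be an arbitrary field. A Leibniz superalgebra is a $\mathbb{Z}_2$-graded $\mathbb{K}$-vector space $\mathfrak{L}=\mathfrak{L}_{\bar 0}\oplus\mathfrak{L}_{\bar 1}$ (of arbitrary dimension) with a bilinear product $[\cdot,\cdot]$ such that, for homogeneous $x\in\mathfrak{L}_{\bar i}$, $y\in\mathfrak{L}_{\bar j}$, $z\in\mathfrak{L}_{\bar k}$, one has $[x,y]\in\mathfrak{L}_{\bar i+\bar j}$ and $[x,[y,z]]=[[x,y],z]-(-1)^{\bar j\bar k}[[x,z],y]$. For subspaces $A,B$, $[A,B]$ denotes the linear span of the products $[a,b]$. A subalgebra is a graded subspace $A$ with $[A,A]\subset A$; it is abelian if $[A,A]=0$. An ideal is a graded subspace $I=I_{\bar 0}\oplus I_{\bar 1}$ with $[I,\mathfrak{L}]+[\mathfrak{L},I]\subset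 I$. $\mathfrak{I}=\mathfrak{I}_{\bar 0}\oplus\mathfrak{I}_{\bar 1}$ denotes the (graded) ideal of $\mathfrak{L}$ generated by $\{[x,y]+(-1)^{\bar i\bar j}[y,x]:x\in\mathfrak{L}_{\bar i},y\in\mathfrak{L}_{\bar j},\ \bar i,\bar j\in\mathbb{Z}_2\}$. $\mathfrak{L}$ is simple if $[\mathfrak{L},\mathfrak{L}]\neq0$ and its only (graded) ideals are $\{0\}$, $\mathfrak{I}$ and $\mathfrak{L}$. Split: let $H=H_{\bar 0}\oplus H_{\bar 1}$ be a maximal element among the abelian graded subalgebras of $\mathfrak{L}$. For a linear functional $\alpha:H_{\bar 0}\to\mathbb{K}$ put $\mathfrak{L}_\alpha:=\{v\in\mathfrak{L}:[v,h]=\alpha(h)v\ \text{for all } h\in H_{\bar 0}\}$, $\mathfrak{L}_{\alpha,\bar i}:=\mathfrak{L}_\alpha\cap\mathfrak{L}_{\bar i}$ (so $\mathfrak{L}_\alpha=\mathfrak{L}_{\alpha,\bar 0}\oplus\mathfrak{L}_{\alpha,\bar 1}$), and $\Lambda:=\{\alpha\in(H_{\bar 0})^*\setminus\{0\}:\mathfrak{L}_\alpha\neq0\}$. $\mathfrak{L}$ is split if $\mathfrak{L}=H\oplus\bigoplus_{\alpha\in\Lambda}\mathfrak{L}_\alpha$. It is of maximal length if $\dim\mathfrak{L}_{\alpha,\bar i}\in\{0,1\}$ for all $\alpha\in\Lambda$, $\bar i\in\mathbb{Z}_2$. For $\bar i\in\mathbb{Z}_2$: $\Lambda_{\bar i}^{\mathfrak{I}}:=\{\gamma\in\Lambda:\mathfrak{I}_{\bar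 i}\cap\mathfrak{L}_{\gamma,\bar i}\neq0\}$, $\Lambda_{\bar i}^{\neg\mathfrak{I}}:=\{\gamma\in\Lambda:\mathfrak{L}_{\gamma,\bar i}\neq0,\ \mathfrak{I}_{\bar i}\cap\mathfrak{L}_{\gamma,\bar i}=0\}$, and $\Lambda^{\Upsilon}:=\Lambda_{\bar 0}^{\Upsilon}\cup\Lambda_{\bar 1}^{\Upsilon}$ for $\Upsilon\in\{\mathfrak{I},\neg\mathfrak{I}\}$. $\neg\mathfrak{I}$-connection: let $\alpha\in\Lambda_{\bar i}^{\Upsilon}$, $\beta\in\Lambda_{\bar j}^{\Upsilon}$ with $\Upsilon\in\{\mathfrak{I},\neg\mathfrak{I}\}$. $\alpha$ is $\neg\mathfrak{I}$-connected to $\beta$ if either $\beta\in\{\alpha,-\alpha\}$, or there are nonzero roots $\alpha_1=\alpha,\alpha_2,\dots,\alpha_n$ with $\alpha_k\in\Lambda_{\bar i_k}^{\neg\mathfrak{I}}$ for some $\bar i_k\in\mathbb{Z}_2$ ($k=2,\dots,n$), such that $\alpha_1+\cdots+\alpha_k\in\Lambda_{\bar i+\bar i_2+\cdots+\bar i_k}^{\Upsilon}$ for every $k=2,\dots,n$, $\alpha_1+\cdots+\alpha_n=\beta$ and $\bar i+\bar i_2+\cdots+\bar i_n=\bar j$. $\Lambda^{\Upsilon}$ has all of its elements (roots) $\neg\mathfrak{I}$-connected if for any $\bar i,\bar j\in\mathbb{Z}_2$ every root in $\Lambda_{\bar i}^{\Upsilon}$ is $\neg\mathfrak{I}$-connected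 to every root in $\Lambda_{\bar j}^{\Upsilon}$. $\mathfrak{L}$ (of maximal length) is root-multiplicative if: (1) for $\alpha\in\Lambda_{\bar i}^{\neg\mathfrak{I}}$, $\beta\in\Lambda_{\bar j}^{\neg\mathfrak{I}}$ with $\alpha+\beta\in\Lambda$ one has $[\mathfrak{L}_{\alpha,\bar i},\mathfrak{L}_{\beta,\bar j}]\neq0$; and (2) for $\alpha\in\Lambda_{\bar i}^{\neg\mathfrak{I}}$, $\gamma\in\Lambda_{\bar j}^{\mathfrak{I}}$ with $\alpha+\gamma\in\Lambda^{\mathfrak{I}}$ one has $[\mathfrak{L}_{\gamma,\bar j},\mathfrak{L}_{\alpha,\bar i}]\neq0$. Lie-annihilator: $\mathcal{Z}_{Lie}(\mathfrak{L}):=\{v\in\mathfrak{L}:[v,\mathfrak{L}_\alpha]+[\mathfrak{L}_\alpha,v]=0\ \text{for any }\alpha\in\Lambda\text{ with }\alpha\notin\Lambda^{\mathfrak{I}}\}$. *)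

(* Defs.v *)
From HB Require Import structures.
From mathcomp Require Import all_boot all_order all_algebra.
From mathcomp Require Import boolp classical_sets functions cardinality fsbigop.

Set Implicit Arguments.
Unset Strict Implicit.
Unset Printing Implicit Defensive.

Import GRing.Theory.
Local Open Scope classical_set_scope.
Local Open Scope card_scope.
Local Open Scope ring_scope.

Section LinearAlgebra.
Variables (K : fieldType) (V : lmodType K).
Implicit Types A B : set V.

Definition subspace A : Prop := submod_closed [in A].

Definition lin_span A : set V := smallest subspace A.

Definition sum_subspace A B : set V := [set a + b | a in A & b in B].

(* A has dimension n: the linear map K^n -> V attached to some family e of
   n vectors is injective with range A. *)
Definition has_dim A (n : nat) : Prop :=
  exists e : 'I_n -> V,
    let f := fun c : 'rV[K]_n => \sum_(i < n) c 0 i *: e i in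
    injective f /\ A = range f.

End LinearAlgebra.

(* The operator [bracket] is the product of the superalgebra, and [homog i] is
   its homogeneous component of parity i. *)
HB.mixin Record isLeibnizSuperalgebra (K : fieldType) L of GRing.Lmodule K L :=
{
  homog : 'Z_2 -> set L;
  homog_subspace : forall i, subspace (homog i);
  homog_direct : forall v : L, exists! p : L * L,
    [/\ homog 0 p.1, homog 1 p.2 & v = p.1 + p.2];
  bracket : L -> L -> L;
  bracket_bilinear : bilinear_for *:%R *:%R bracket;
  bracket_homog : forall (i j : 'Z_2) x y,
    homog i x -> homog j y -> homog (i + j) (bracket x y);
  leibniz_super : forall (i j k : 'Z_2) x y z,
    homog i x -> homog j y -> homog k z ->
    bracket x (bracket y z) =
      bracket (bracket x y) z - (-1) ^+ (j * k)%N *: bracket (bracket x z) y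
}.

#[short(type="leibnizSuperType")]
HB.structure Definition LeibnizSuperalgebra (K : fieldType) :=
  { L of isLeibnizSuperalgebra K L & GRing.Lmodule K L }.

HB.instance Definition _ (K : fieldType) (L : leibnizSuperType K) :=
  bilinear_isBilinear.Build K L L L *:%R *:%R (@bracket K L) bracket_bilinear.

Section Superalgebra.
Variables (K : fieldType) (L : leibnizSuperType K).
Implicit Types A B : set L.

Definition bracket_set A B : set L :=
  lin_span [set bracket a b | a in A & b in B].

Definition graded_subspace A : Prop :=
  subspace A /\ A = sum_subspace (A `&` homog 0) (A `&` homog 1).

Definition subalgebra A : Prop :=
  graded_subspace A /\ bracket_set A A `<=` A.

Definition abelian_subalgebra A : Prop :=
  subalgebra A /\ bracket_set A A = [set 0].

Definition maximal_abelian A : Prop :=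
  abelian_subalgebra A /\ forall B, abelian_subalgebra B -> A `<=` B -> B = A.

Definition ideal A : Prop :=
  graded_subspace A /\
  sum_subspace (bracket_set A setT) (bracket_set setT A) `<=` A.

(* The ideal that measures how far L is from being a Lie superalgebra. *)
Definition lie_kernel : set L :=
  smallest ideal [set w | exists (i j : 'Z_2) (x y : L),
    [/\ homog i x, homog j y & w = bracket x y + (-1) ^+ (i * j)%N *: bracket y x]].

Definition is_simple : Prop :=
  bracket_set setT setT <> [set 0 : L] /\
  forall A, ideal A -> [\/ A = [set 0], A = lie_kernel | A = setT].

End Superalgebra.

Arguments lie_kernel {K L}.
Arguments is_simple {K} L.

Record max_abelian_subalg (K : fieldType) (L : leibnizSuperType K) :=
  MaxAbelianSubalg {
    mas_set :> set L;
    mas_maximal : maximal_abelian mas_set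
  }.

Section EvenPart.
Variables (K : fieldType) (L : leibnizSuperType K) (H : max_abelian_subalg L).

Definition even_pred : {pred L} := [in (H : set L) `&` homog 0].

Lemma even_pred_submod : submod_closed even_pred.
Proof.
have [[[[[H0 HD] _] _] _] _] := mas_maximal H.
have [L0 LD] := homog_subspace (s := L) 0.
split=> [|a u v]; rewrite !in_setI ?H0 ?L0 //.
by move=> /andP[uH uL] /andP[vH vL]; rewrite HD ?LD.
Qed.

HB.instance Definition _ :=
  GRing.isSubmodClosed.Build K L even_pred even_pred_submod.

(* The even part of H, as a vector space in its own right. *)
Record even_part := EvenPart { even_val : L; _ : even_val \in even_pred }.

HB.instance Definition _ := [isSub for even_val].
HB.instance Definition _ := [Choice of even_part by <:].
HB.instance Definition _ := [SubChoice_isSubLmodule of even_part by <:].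

End EvenPart.

(* The two values of the superscript of Lambda: roots met by the ideal
   [lie_kernel], and roots not met by it. *)
Variant root_kind := InKernel | OffKernel.

Section Roots.
Variables (K : fieldType) (L : leibnizSuperType K) (H : max_abelian_subalg L).

(* Elements of the dual of the even part of H are the functions of this type
   that are [scalar]; the type carries pointwise 0, + and -. *)
Notation functional := (even_part H -> K).
Implicit Types a b c : functional.

Definition root_space a : set L :=
  [set v | forall h : even_part H, bracket v (val h) = a h *: v].

Definition root_space_par a (i : 'Z_2) : set L := root_space a `&` homog i.

Definition root_set : set functional :=
  [set a | [/\ scalar a, a <> 0 & root_space a <> [set 0]]].

(* Every vector is, in exactly one way, an element of H plus a finite sum of
   elements of root spaces; the component d.2 a is set to 0 off [root_set]. *)
Definition is_split : Prop :=
  forall v : L, exists! d : L * (functional -> L),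
    [/\ (H : set L) d.1,
        forall a, root_set a -> root_space a (d.2 a),
        forall a, ~ root_set a -> d.2 a = 0,
        finite_set [set a | d.2 a <> 0] &
        v = d.1 + \sum_(a \in root_set) d.2 a].

Definition is_maximal_length : Prop :=
  forall a i, root_set a ->
    has_dim (root_space_par a i) 0 \/ has_dim (root_space_par a i) 1.

Definition roots_par (k : root_kind) (i : 'Z_2) : set functional :=
  let kernel_part a := (lie_kernel `&` homog i) `&` root_space_par a i in
  match k with
  | InKernel => [set a | root_set a /\ kernel_part a <> [set 0]]
  | OffKernel => [set a | [/\ root_set a, root_space_par a i <> [set 0]
                            & kernel_part a = [set 0]]]
  end.

Definition roots_kind (k : root_kind) : set functional :=
  roots_par k 0 `|` roots_par k 1.

(* The chain is r 1, ..., r n, with parities p 1, ..., p n; values of r and p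
   at other indices are irrelevant. *)
Definition offK_connected (k : root_kind) (i : 'Z_2) a (j : 'Z_2) b : Prop :=
  (b = a \/ b = - a) \/
  exists (n : nat) (r : nat -> functional) (p : nat -> 'Z_2),
    [/\ (1 <= n)%N /\ (r 1%N = a /\ p 1%N = i),
        forall m, (2 <= m <= n)%N -> roots_par OffKernel (p m) (r m),
        forall m, (2 <= m <= n)%N ->
          roots_par k (\sum_(1 <= l < m.+1) p l) (\sum_(1 <= l < m.+1) r l),
        \sum_(1 <= l < n.+1) r l = b &
        \sum_(1 <= l < n.+1) p l = j].

Definition all_offK_connected (k : root_kind) : Prop :=
  forall (i j : 'Z_2) a b,
    roots_par k i a -> roots_par k j b -> offK_connected k i a j b.

Definition is_root_multiplicative : Prop :=
  (forall (i j : 'Z_2) a b,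
     roots_par OffKernel i a -> roots_par OffKernel j b -> root_set (a + b) ->
     bracket_set (root_space_par a i) (root_space_par b j) <> [set 0]) /\
  (forall (i j : 'Z_2) a c,
     roots_par OffKernel i a -> roots_par InKernel j c ->
     roots_kind InKernel (a + c) ->
     bracket_set (root_space_par c j) (root_space_par a i) <> [set 0]).

Definition lie_annihilator : set L :=
  [set v | forall a, root_set a -> ~ roots_kind InKernel a ->
     sum_subspace (bracket_set [set v] (root_space a))
                  (bracket_set (root_space a) [set v]) = [set 0]].

End Roots.

Arguments root_set {K L} H _.
Arguments roots_kind {K L} H k _.
Arguments all_offK_connected {K L} H k.
Arguments lie_annihilator {K L} H _.

(* Main.v *)
Require Import Defs.
From HB Require Import structures.
From mathcomp Require Import all_boot all_order all_algebra.
From mathcomp Require Import boolp classical_sets functions cardinality fsbigop.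

Set Implicit Arguments.
Unset Strict Implicit.
Unset Printing Implicit Defensive.

Import GRing.Theory.
Local Open Scope classical_set_scope.
Local Open Scope card_scope.
Local Open Scope ring_scope.
(** Write I for the kernel [lie_kernel], and call a pair (root, parity) a weight.
    By the Leibniz identity right multiplication by a vector of I is zero, and
    modulo I the product is that of a Lie superalgebra.  Ideals are spanned by
    the weight vectors that they contain ([wvec_ideal_span]), nonzero weight
    spaces are lines, and I meets H in 0 because the Lie annihilator is 0.
    Hence a weight space for a nonzero root lies in I or meets it in 0, and the
    connection relation becomes a graph on weights: [c] leads to [c + d] when
    [c + d] is a weight of the same kind as [c] and [d] a weight off I
    ([reach]).

    If the roots are connected, root-multiplicativity carries a weight space
    contained in an ideal J along chains.  If J contains a weight space off I,
    it contains all of them, hence H, which their products span, hence all of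
    the superalgebra.  Otherwise J meets H in 0, so J is inside I, and if J is
    nonzero it contains all weight spaces of I ([connected_simple]).

    Conversely, let the superalgebra be simple.  A root vector [x] generates an
    ideal spanned, up to I, by words [x ** y1 ** ... ** yn] in root vectors
    [yi] ([word_span_ideal]).  So for two weights [a] and [b] of the same kind
    some word from [a] to [b] is nonzero (not in I, in the second case), and its
    letters are off I.  Inside I no partial product of the word has weight in H,
    and the word is a chain.  Off I the word may pass through H, and these
    passages have to be removed with the Leibniz identity.

    - If the roots of [a] and [b] are not proportional over the prime field,
      letters outside the line of [a] can be brought to the front and letters
      inside the line of [b] distributed over two factors outside that line, so
      that no partial sum is zero ([diff_line_reach]).
    - If some root is off the line of [a], it serves as an intermediate step.
    - Otherwise all roots are on one line.  If the root of [b] is neither that of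
      [a] nor its opposite, the characteristic is neither 2 nor 3, and no root
      vanishes on a nonzero even element of H.  The root vectors of some even
      weight [r] and of [- r] then generate a copy of sl_2.
      Call a weight nondegenerate when its root vector has a nonzero product
      with an opposite one of the same parity; that product acts on every root
      vector off I by a nonzero scalar, so a nondegenerate weight reaches every weight
      outside its own block, that is, outside its root and the opposite one
      ([nondegenerate_reach]).  The action of sl_2 shows that the passages
      through H can be removed from a word until it meets a nondegenerate weight
      ([word_reach_nondegenerate]).  The exceptional configurations are excluded
      because root-multiplicativity forbids an even root and its double to be
      both off I ([even_double]) and, with the super Jacobi identity, the odd
      weights [2 r] and [- r] to occur together ([off_2_1_excl]). *)

Local Notation "x ** y" := (bracket x y) (at level 40, left associativity).

(** * Subspaces, products and ideals *)

Lemma Z2_cases (i : 'Z_2) : i = 0 \/ i = 1.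
Proof. by case: i => [[|[|]]] //= ?; [left|right]; apply: val_inj. Qed.

Lemma Z2_char (i : 'Z_2) : i + i = 0.
Proof. by case: (Z2_cases i) => ->; apply: val_inj. Qed.

Lemma Z2_opp (i : 'Z_2) : - i = i.
Proof. by case: (Z2_cases i) => ->; apply/eqP. Qed.

Section Subspaces.
Context {K : fieldType} {V : lmodType K}.
Implicit Types A B : set V.

Lemma subspaceP A :
  subspace A <-> A 0 /\ forall a u v, A u -> A v -> A (a *: u + v).
Proof.
split=> [[A0 AD]|[A0 AD]]; split.
- by move: A0; rewrite in_setE.
- by move=> a u v Au Av; move: (AD a u v); rewrite !in_setE; apply.
- by rewrite in_setE.
- by move=> a u v; rewrite !in_setE; apply: AD.
Qed.

Lemma subspace0 A : subspace A -> A 0. Proof. by case/subspaceP. Qed.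

Lemma subspaceD A u v : subspace A -> A u -> A v -> A (u + v).
Proof. by case/subspaceP=> _ AD Au Av; rewrite -[u]scale1r; apply: AD. Qed.

Lemma subspaceZ A a u : subspace A -> A u -> A (a *: u).
Proof.
case/subspaceP=> A0 AD Au; rewrite -[_ *: _]addr0.
by apply: AD.
Qed.

Lemma subspaceN A u : subspace A -> A u -> A (- u).
Proof. by move=> sA Au; rewrite -scaleN1r; apply: subspaceZ. Qed.

Lemma subspaceB A u v : subspace A -> A u -> A v -> A (u - v).
Proof. by move=> sA Au Av; apply: subspaceD => //; apply: subspaceN. Qed.

Lemma subspaceZI A a u : subspace A -> a != 0 -> A (a *: u) -> A u.
Proof.
by move=> sA a0 /(subspaceZ a^-1 sA); rewrite scalerA mulVf // scale1r.
Qed.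

Lemma subspace_addIl A u v : subspace A -> A v -> A (u + v) -> A u.
Proof. by move=> sA Av /subspaceB /(_ Av); rewrite addrK; apply. Qed.

Lemma subspace_sum A (T : Type) (s : seq T) (P : pred T) (F : T -> V) :
  subspace A -> (forall i, P i -> A (F i)) -> A (\sum_(i <- s | P i) F i).
Proof.
move=> sA AF; elim/big_ind: _ => //; first exact: subspace0.
by move=> *; apply: subspaceD.
Qed.

Lemma subspace_set0 : subspace [set 0 : V].
Proof.
by apply/subspaceP; split=> // a u v /= -> ->; rewrite scaler0 addr0.
Qed.

Lemma subspace_lin_span A : subspace (lin_span A).
Proof.
apply/subspaceP; split; first by move=> B [sB _]; apply: subspace0.
move=> a u v Au Av B BA; case: (BA) => sB _.
by apply: subspaceD => //; [apply: subspaceZ => //; apply: Au|apply: Av].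
Qed.

Lemma sub_lin_span A : A `<=` lin_span A.
Proof. by move=> v Av B [_]; apply. Qed.

Lemma lin_span_le A B : subspace B -> A `<=` B -> lin_span A `<=` B.
Proof. by move=> sB AB v; apply. Qed.

Lemma not_set0_ex A : subspace A -> A <> [set 0] -> exists2 v, A v & v <> 0.
Proof.
move=> sA A0; apply: contrapT => nex; apply: A0; apply/seteqP; split=> v /=.
  by move=> Av; apply: contrapT => v0; apply: nex; exists v.
by move=> ->; apply: subspace0.
Qed.

Lemma sum_subspacel A B v : subspace B -> A v -> sum_subspace A B v.
Proof. by move=> sB Av; exists v => //; exists 0; rewrite ?addr0 //; apply: subspace0. Qed.

Lemma sum_subspacer A B v : subspace A -> B v -> sum_subspace A B v.
Proof. by move=> sA Bv; exists 0; [apply: subspace0|exists v; rewrite ?add0r]. Qed.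

End Subspaces.

Section Brackets.
Context {K : fieldType} {L : leibnizSuperType K}.
Implicit Types (x y z : L) (A B J : set L).

Lemma brDl x y z : (x + y) ** z = x ** z + y ** z. Proof. exact: linearDl. Qed.
Lemma brDr x y z : z ** (x + y) = z ** x + z ** y. Proof. exact: linearDr. Qed.
Lemma br0l x : 0 ** x = 0. Proof. exact: linear0l. Qed.
Lemma br0r x : x ** 0 = 0. Proof. exact: linear0r. Qed.
Lemma brZl (a : K) x y : (a *: x) ** y = a *: (x ** y). Proof. exact: linearZl_LR. Qed.
Lemma brZr (a : K) x y : x ** (a *: y) = a *: (x ** y). Proof. exact: linearZr_LR. Qed.
Lemma brNl x y : (- x) ** y = - (x ** y). Proof. by rewrite -scaleN1r brZl scaleN1r. Qed.
Lemma brBl x y z : (x - y) ** z = x ** z - y ** z. Proof. by rewrite brDl brNl. Qed.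

Lemma br_suml (T : Type) (s : seq T) (P : pred T) (F : T -> L) z :
  (\sum_(i <- s | P i) F i) ** z = \sum_(i <- s | P i) F i ** z.
Proof. exact: (big_morph (fun x => x ** z) (fun x y => brDl x y z) (br0l z)). Qed.

Lemma bracket_setE A B x y : A x -> B y -> bracket_set A B (x ** y).
Proof. by move=> Ax By; apply: sub_lin_span; exists x => //; exists y. Qed.

Lemma bracket_set_neq0 A B :
  bracket_set A B <> [set 0] -> exists x y, [/\ A x, B y & x ** y <> 0].
Proof.
move=> AB0; apply: contrapT => nex; apply: AB0; apply/seteqP; split=> v /=.
  apply: (lin_span_le (B := [set 0])); first exact: subspace_set0.
  move=> _ [x Ax [y By <-]] /=; apply: contrapT => xy0.
  by apply: nex; exists x, y.
by move=> ->; apply: subspace0; apply: subspace_lin_span.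
Qed.

Lemma parity_split v : exists x y, [/\ homog 0 x, homog 1 y & v = x + y].
Proof. by case: (homog_direct v) => -[x y] [[h0 h1 ->] _]; exists x, y. Qed.

Lemma parity_uniq x y x' y' :
  homog 0 x -> homog 1 y -> homog 0 x' -> homog 1 y' -> x + y = x' + y' ->
  x = x' /\ y = y'.
Proof.
move=> hx hy hx' hy' e; case: (homog_direct (x + y)) => p [_ u].
have e1 : p = (x, y) by apply: u.
have e2 : p = (x', y') by apply: u.
by move: e2; rewrite e1 => -[].
Qed.

Lemma homog_sub i : subspace (@homog K L i). Proof. exact: homog_subspace. Qed.

Lemma graded_comp A i x y : graded_subspace A ->
  homog i x -> homog (i + 1) y -> A (x + y) -> A x /\ A y.
Proof.
move=> [sA eA]; have main u v : homog 0 u -> homog 1 v -> A (u + v) -> A u /\ A v.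
  move=> hu hv; rewrite {1}eA => -[u' [Au' hu'] [v' [Av' hv'] e]].
  by have [<- <-] := parity_uniq hu' hv' hu hv e.
case: (Z2_cases i) => ->.
  rewrite add0r; exact: main.
have -> : 1 + 1 = 0 :> 'Z_2 by apply: val_inj.
by move=> hx hy; rewrite addrC => /(main _ _ hy hx)[].
Qed.

Lemma graded_intro A : subspace A ->
  (forall x y, homog 0 x -> homog 1 y -> A (x + y) -> A x) -> graded_subspace A.
Proof.
move=> sA Ax; split=> //; apply/seteqP; split=> v.
  move=> Av; have [x [y [hx hy e]]] := parity_split v; subst v.
  have Ax' : A x by apply: Ax Av.
  exists x => //; exists y => //; split=> //.
  by apply: subspace_addIl Ax' _ => //; rewrite addrC.
by move=> [x [Ax' _] [y [Ay _] <-]]; apply: subspaceD.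
Qed.

Lemma homog_both x : homog 0 x -> homog 1 x -> x = 0.
Proof.
move=> h0 h1; have z0 := subspace0 (@homog_sub 0); have z1 := subspace0 (@homog_sub 1).
by have [] := parity_uniq h0 z1 z0 h1 (addrC _ _).
Qed.

Lemma graded_set0 : graded_subspace [set 0 : L].
Proof.
apply: graded_intro; first exact: subspace_set0.
move=> x y hx hy /= e; have [-> //] : x = 0 /\ y = 0.
apply: parity_uniq => //; try exact: subspace0 (homog_sub _).
by rewrite e addr0.
Qed.

Section Ideal.
Variable J : set L.
Hypothesis J_id : ideal J.

Lemma ideal_graded : graded_subspace J. Proof. by case: J_id. Qed.
Lemma ideal_subspace : subspace J. Proof. by case: ideal_graded. Qed.

Lemma idealMr x y : J x -> J (x ** y).
Proof.
move=> Jx; case: J_id => _; apply; apply: sum_subspacel.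
  exact: subspace_lin_span.
exact: bracket_setE.
Qed.

Lemma idealMl x y : J x -> J (y ** x).
Proof.
move=> Jx; case: J_id => _; apply; apply: sum_subspacer.
  exact: subspace_lin_span.
exact: bracket_setE.
Qed.

End Ideal.

Lemma ideal_intro J : graded_subspace J ->
  (forall x y, J x -> J (x ** y)) -> (forall x y, J x -> J (y ** x)) -> ideal J.
Proof.
move=> gJ Jr Jl; split=> // v [a aJ [b bJ <-]]; have [sJ _] := gJ.
apply: subspaceD => //.
  apply: (lin_span_le sJ) aJ => _ [x Jx [y _ <-]]; exact: Jr.
apply: (lin_span_le sJ) bJ => _ [x _ [y Jy <-]]; exact: Jl.
Qed.

Lemma ideal_set0 : ideal [set 0 : L].
Proof.
apply: ideal_intro => [|x y /= ->|x y /= ->]; first exact: graded_set0.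
  exact: br0l.
exact: br0r.
Qed.

Lemma ideal_lie_kernel : ideal (@lie_kernel K L).
Proof.
apply: ideal_intro.
- apply: graded_intro.
    apply/subspaceP; split=> [M [iM _]|a u v Mu Mv M Mi].
      exact: subspace0 (ideal_subspace iM).
    have sM := ideal_subspace Mi.1.
    apply: subspaceD => //; last exact: Mv.
    by apply: subspaceZ => //; apply: Mu.
  move=> x y hx hy Mxy M Mi.
  by have [] := @graded_comp M 0 x y (ideal_graded Mi.1) hx _ (Mxy _ Mi); rewrite ?add0r.
- by move=> x y Ix M Mi; apply: idealMr; [case: Mi|apply: Ix].
- by move=> x y Ix M Mi; apply: idealMl; [case: Mi|apply: Ix].
Qed.

Lemma skew i j x y : homog i x -> homog j y ->
  lie_kernel (x ** y + (-1) ^+ (i * j)%N *: (y ** x)).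
Proof. by move=> hx hy M [_]; apply; exists i, j, x, y. Qed.

Lemma right_annih_homog x :
  (forall i y, homog i y -> y ** x = 0) -> forall y, y ** x = 0.
Proof.
move=> x0 y; have [y0 [y1 [h0 h1 ->]]] := parity_split y.
by rewrite brDl (x0 _ _ h0) (x0 _ _ h1) addr0.
Qed.

(** The vectors annihilated by all left multipliers form an ideal.  It contains
    the generators of the kernel, since the Leibniz expansions of [y ** (u ** v)]
    and [y ** (v ** u)] agree up to the sign that makes them cancel. *)
Lemma kernel_right x y : lie_kernel x -> y ** x = 0.
Proof.
pose A : set L := [set x | forall y, y ** x = 0].
suff : lie_kernel `<=` A by move=> IA Ix; apply: IA.
apply: smallest_sub.
  have gA : graded_subspace A.
    apply: graded_intro.
      apply/subspaceP; split=> [z|a u v Au Av z]; first exact: br0r.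
      by rewrite brDr brZr Au Av scaler0 addr0.
    move=> u v hu hv Auv; apply: right_annih_homog.
    move=> i z hz /=; have := Auv z; rewrite brDr.
    have zu : homog i (z ** u) by rewrite -[i]addr0; apply: bracket_homog.
    by move=> e; have [] := graded_comp graded_set0 zu (bracket_homog _ _ _ _ hz hv) e.
  have Ar u z : A u -> A (u ** z).
    move=> Au; have [u0 [u1 [h0 h1 e]]] := parity_split u.
    have [z0 [z1 [k0 k1 ->]]] := parity_split z.
    have [A0 A1] : A u0 /\ A u1.
      by apply: (@graded_comp A 0) => //; rewrite ?add0r // -e.
    apply: right_annih_homog.
    have aux i j k w p q : homog i w -> homog j p -> homog k q -> A p ->
        w ** (p ** q) = 0.
      move=> hw hp hq Ap; rewrite (leibniz_super _ _ _ _ _ _ hw hp hq) !Ap br0l.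
      by rewrite scaler0 subr0.
    move=> i w hw /=; rewrite e !brDl !brDr.
    by rewrite (aux _ _ _ _ _ _ hw h0 k0 A0) (aux _ _ _ _ _ _ hw h0 k1 A0)
      (aux _ _ _ _ _ _ hw h1 k0 A1) (aux _ _ _ _ _ _ hw h1 k1 A1) !addr0.
  apply: ideal_intro => // u z Au v.
  have -> : z ** u = 0 by apply: Au.
  exact: br0r.
move=> _ [i [j [u [v [hu hv ->]]]]] /=.
apply: right_annih_homog.
move=> k z hz /=; rewrite brDr brZr (leibniz_super _ _ _ _ _ _ hz hu hv) (leibniz_super _ _ _ _ _ _ hz hv hu).
rewrite (mulnC j i) scalerBr scalerA -expr2 sqrr_sign scale1r.
by rewrite addrA subrK subrr.
Qed.

End Brackets.

(** * Weight vectors *)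

Section Weights.
Context {K : fieldType} {L : leibnizSuperType K} {H : max_abelian_subalg L}.
Implicit Types (x y z v : L) (C J : set L).

Definition weight : Type := ((even_part H -> K) * 'Z_2)%type.
Implicit Types (a b c d w : weight).

Definition wvec w : set L :=
  [set x | [/\ scalar w.1, root_space w.1 x & homog w.2 x]].

Lemma scalar_fun0 : scalar (0 : even_part H -> K).
Proof.
move=> k u v; have e h : (0 : even_part H -> K) h = 0 by [].
by rewrite !e mulr0 addr0.
Qed.

Lemma scalar_funD (f g : even_part H -> K) : scalar f -> scalar g -> scalar (f + g).
Proof. by move=> sf sg k u v; rewrite !fctE sf sg /= mulrDr addrACA. Qed.

Lemma scalar_funN (f : even_part H -> K) : scalar f -> scalar (- f).
Proof. by move=> sf k u v; rewrite !fctE sf /= mulrN opprD. Qed.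

Lemma subspace_root_space (f : even_part H -> K) : subspace (root_space f).
Proof.
apply/subspaceP; split=> [h|k u v hu hv h]; first by rewrite br0l scaler0.
by rewrite brDl brZl hu hv scalerDr !scalerA mulrC.
Qed.

Lemma wvecZ w k x : wvec w x -> wvec w (k *: x).
Proof.
case=> sw rw hw; split=> //; first exact: subspaceZ (subspace_root_space _) rw.
exact: subspaceZ (homog_sub _) hw.
Qed.

Lemma wvecD w x y : wvec w x -> wvec w y -> wvec w (x + y).
Proof.
move=> [sw rx hx] [_ ry hy]; split=> //.
  exact: subspaceD (subspace_root_space _) rx ry.
exact: subspaceD (homog_sub _) hx hy.
Qed.

Lemma even_part_homog (h : even_part H) : homog 0 (val h).
Proof. by case: h => h /=; rewrite /even_pred in_setE => -[]. Qed.

Lemma even_part_mem (h : even_part H) : mas_set H (val h).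
Proof. by case: h => h /=; rewrite /even_pred in_setE => -[]. Qed.

Lemma even_part_ex h : mas_set H h -> homog 0 h -> exists h' : even_part H, val h' = h.
Proof.
move=> Hh h0; have hh : h \in even_pred H by rewrite /even_pred in_setE.
by exists (EvenPart hh).
Qed.

Lemma root_space_br (f g : even_part H -> K) j x y :
  root_space f x -> root_space g y -> homog j y -> root_space (f + g) (x ** y).
Proof.
move=> rx ry hy h.
have aux i u : homog i u ->
    u ** y ** val h = u ** (y ** val h) + u ** val h ** y.
  move=> hu; rewrite (leibniz_super _ _ _ _ _ _ hu hy (even_part_homog h)).
  by rewrite muln0 scale1r subrK.
have [x0 [x1 [h0 h1 e]]] := parity_split x.
have -> : x ** y ** val h = x ** (y ** val h) + x ** val h ** y.
  by rewrite e !brDl (aux _ _ h0) (aux _ _ h1) addrACA.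
by rewrite ry rx brZr brZl -scalerDl fctE addrC.
Qed.

Lemma wvec_br a b x y : wvec a x -> wvec b y -> wvec (a + b) (x ** y).
Proof.
move=> [sa rx hx] [sb ry hy]; split; first exact: scalar_funD.
  exact: root_space_br ry hy.
exact: bracket_homog.
Qed.

Lemma wvec_leibniz a b c x y z : wvec a x -> wvec b y -> wvec c z ->
  x ** (y ** z) = x ** y ** z - (-1) ^+ (b.2 * c.2)%N *: (x ** z ** y).
Proof. by move=> [_ _ hx] [_ _ hy] [_ _ hz]; apply: leibniz_super hx hy hz. Qed.

Lemma wvec_leibniz_l a b c x y z : wvec a x -> wvec b y -> wvec c z ->
  x ** y ** z = x ** (y ** z) + (-1) ^+ (b.2 * c.2)%N *: (x ** z ** y).
Proof. by move=> wx wy wz; rewrite (wvec_leibniz wx wy wz) subrK. Qed.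

Lemma wvec_skew a b x y : wvec a x -> wvec b y ->
  lie_kernel (x ** y + (-1) ^+ (a.2 * b.2)%N *: (y ** x)).
Proof. by move=> [_ _ hx] [_ _ hy]; apply: skew. Qed.

Lemma root_space_parity (f : even_part H -> K) i x y :
  homog i x -> homog (i + 1) y -> root_space f (x + y) ->
  root_space f x /\ root_space f y.
Proof.
move=> hx hy r.
have shift j h u : homog j u -> homog j (u ** val h - f h *: u).
  move=> hu; apply: subspaceB (homog_sub _) _ (subspaceZ _ (homog_sub _) hu).
  by rewrite -[j]addr0; apply: bracket_homog => //; apply: even_part_homog.
have e h : x ** val h - f h *: x + (y ** val h - f h *: y) = 0.
  by rewrite addrACA -brDl r scalerDr -opprD subrr.
have e2 h := graded_comp graded_set0 (shift _ h _ hx) (shift _ h _ hy) (e h).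
by split=> h; have [e3 e4] := e2 h; apply/eqP; rewrite -subr_eq0; apply/eqP.
Qed.

(** Multiplying by [h] and subtracting [p.1 h] times the vector kills the
    component [p] and rescales the others, which gives an induction on the
    number of components; their roots may repeat. *)
Lemma root_space_separation C (f : even_part H -> K) : subspace C ->
  (forall (h : even_part H) x, C x -> C (x ** val h)) ->
  forall (s : seq ((even_part H -> K) * L)),
    {in s, forall p, p.1 <> f /\ root_space p.1 p.2} ->
  forall v, root_space f v -> C (v + \sum_(p <- s) p.2) -> C v.
Proof.
move=> sC Ch s; move: {2}(size s) (leqnn (size s)) => n.
elim: n s => [|n IHn] [|p s] //= sn ps v rv.
- by rewrite big_nil addr0.
- by rewrite big_nil addr0.
rewrite big_cons => Cv.
have [pf rp] := ps p (mem_head _ _).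
have [h ph] : exists h, p.1 h <> f h.
  apply: contrapT => nex; apply: pf; apply/funext => h.
  by apply: contrapT => ph; apply: nex; exists h.
pose s' := [seq (q.1, (q.1 h - p.1 h) *: q.2) | q <- s].
have fp0 : f h - p.1 h != 0 by rewrite subr_eq0; apply/eqP => e; apply: ph.
apply: (subspaceZI (a := f h - p.1 h)) => //.
apply: (IHn s'); first by rewrite size_map.
- move=> _ /mapP[q qs ->] /=; have [] := ps q; first by rewrite inE qs orbT.
  by move=> qf rq; split=> //; apply: subspaceZ (subspace_root_space _) rq.
- exact: subspaceZ (subspace_root_space _) rv.
have : C ((v + (p.2 + \sum_(j <- s) j.2)) ** val h - p.1 h *: (v + (p.2 + \sum_(j <- s) j.2))).
  by apply: subspaceB => //; [apply: Ch|apply: subspaceZ].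
rewrite !brDl rv rp !scalerDr !opprD addrACA -scalerBl addrACA subrr add0r.
congr (C (_ + _)); rewrite /s' big_map /= br_suml scaler_sumr -sumrB.
apply: eq_big_seq => q qs /=; rewrite scalerBl; congr (_ - _).
by have [|_ ->] := ps q; rewrite // inE qs orbT.
Qed.

(** Components of the wrong parity are first removed because [C] is graded. *)
Lemma wvec_separation C b : graded_subspace C ->
  (forall (h : even_part H) x, C x -> C (x ** val h)) ->
  forall (s : seq (weight * L)),
    {in s, forall p, p.1 <> b /\ wvec p.1 p.2} ->
  forall v, wvec b v -> C (v + \sum_(p <- s) p.2) -> C v.
Proof.
move=> gC Ch s ps v [sb rv hv]; have [sC _] := gC.
rewrite (bigID (fun p : weight * L => p.1.2 == b.2)) /= addrA => Cv.
have [{}Cv _] : C (v + \sum_(p <- s | p.1.2 == b.2) p.2) /\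
    C (\sum_(p <- s | p.1.2 != b.2) p.2).
  apply: graded_comp gC _ _ Cv.
    apply: subspaceD (homog_sub _) hv _; rewrite big_seq_cond.
    apply: subspace_sum (homog_sub _) _ => p /andP[/ps[_ [_ _ hp]] /eqP <-] //.
  rewrite big_seq_cond; apply: subspace_sum (homog_sub _) _.
  move=> p /andP[/ps[_ [_ _ hp]]] ne.
  suff -> : b.2 + 1 = p.1.2 by [].
  move: ne; case: (Z2_cases b.2) => ->; case: (Z2_cases p.1.2) => -> //= _;
  exact: val_inj.
pose s' := [seq (p.1.1, p.2) | p <- s & p.1.2 == b.2].
apply: (@root_space_separation C b.1 sC Ch s') => //.
  move=> q /mapP[p]; rewrite mem_filter => /andP[/eqP pb /ps[nb [_ rp _]]] -> /=.
  by split=> // e; apply: nb; rewrite [LHS]surjective_pairing e pb -surjective_pairing.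
by rewrite /s' big_map big_filter.
Qed.

End Weights.
Arguments weight {K L} H.

(** * The root decomposition *)

Section Split.
Context {K : fieldType} {L : leibnizSuperType K} {H : max_abelian_subalg L}.
Hypothesis L_split : is_split H.
Hypothesis L_max_length : is_maximal_length H.
Implicit Types (x y z v : L) (C J : set L) (a b c d w : weight H).

Lemma mas_subspace : subspace (mas_set H).
Proof. by case: H => h [[[[]]]]. Qed.

Lemma mas_graded : graded_subspace (mas_set H).
Proof. by case: H => h [[[]]]. Qed.

Lemma mas_abelian x y : mas_set H x -> mas_set H y -> x ** y = 0.
Proof.
move=> hx hy; have [[_ e] _] := mas_maximal H.
by have : [set 0] (x ** y) by rewrite -e; apply: bracket_setE.
Qed.

Lemma mas_wvec k x : mas_set H x -> homog k x -> wvec ((0, k) : weight H) x.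
Proof.
move=> hx kx; split=> //; first exact: scalar_fun0.
move=> h; rewrite mas_abelian //; first by rewrite -[RHS]/(0 *: x) scale0r.
exact: even_part_mem.
Qed.

Lemma fsum_subspace (A : set L) (T : choiceType) (P : set T) (F : T -> L) :
  subspace A -> (forall t, A (F t)) -> A (\sum_(t \in P) F t).
Proof. by move=> sA AF; apply: subspace_sum. Qed.

Lemma wvec_gen (A : set L) : subspace A ->
  (forall w x, wvec w x -> A x) -> forall v, A v.
Proof.
move=> sA Aw v.
have Apar (f : even_part H -> K) x : scalar f -> root_space f x -> A x.
  move=> sf; have [y [z [hy hz ->]]] := parity_split x => r.
  have [ry rz] := @root_space_parity _ _ _ f 0 y z hy ltac:(by rewrite add0r) r.
  apply: subspaceD => //.
    by apply: (Aw (f, 0 : 'Z_2) y).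
    by apply: (Aw (f, 1 : 'Z_2) z).
have [[h g] [[/= Hh gr g0 _ ->] _]] := L_split v.
apply: subspaceD => //.
  have [y [z [hy hz e]]] := parity_split h.
  have [Hy Hz] : mas_set H y /\ mas_set H z.
    apply: (@graded_comp _ _ _ 0 y z mas_graded) => //; first by rewrite add0r.
    by rewrite -e.
  by rewrite e; apply: subspaceD => //; [apply: (Aw (0, 0))|apply: (Aw (0, 1))];
    apply: mas_wvec.
apply: fsum_subspace => // f; have [rf|nf] := pselect (root_set H f).
  by apply: (Apar f); [case: rf|apply: gr].
by rewrite g0 //; apply: subspace0.
Qed.

Lemma wvec_sum v : exists2 s : seq (weight H * L),
  {in s, forall p, wvec p.1 p.2} & v = \sum_(p <- s) p.2.
Proof.
pose A : set L := [set v | exists2 s : seq (weight H * L),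
  {in s, forall p, wvec p.1 p.2} & v = \sum_(p <- s) p.2].
suff : A v by [].
apply: wvec_gen.
  apply/subspaceP; split; first by exists [::]; rewrite ?big_nil.
  move=> k u {}v [s hs ->] [t ht ->].
  exists ([seq (p.1, k *: p.2) | p <- s] ++ t).
    move=> p; rewrite mem_cat => /orP[/mapP[q qs ->]|/ht //].
    by have := hs q qs; apply: wvecZ.
  by rewrite big_cat big_map /= scaler_sumr.
move=> w x wx; exists [:: (w, x)]; last by rewrite big_seq1.
by move=> p; rewrite inE => /eqP ->.
Qed.

Lemma wvec_separation0 b v (s : seq (weight H * L)) :
    {in s, forall p, p.1 <> b /\ wvec p.1 p.2} ->
  wvec b v -> v + \sum_(p <- s) p.2 = 0 -> v = 0.
Proof.
move=> hs wv e; apply: (@wvec_separation _ _ _ [set 0] b graded_set0 _ s hs v wv e).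
by move=> h x /= ->; rewrite br0l.
Qed.

(** Subtracting from [x] its component in H leaves a vector of weight zero that
    is a sum of vectors of nonzero weights. *)
Lemma wvec0_mas w x : wvec w x -> w.1 = 0 -> mas_set H x.
Proof.
move=> wx w0; have [[h g] [[/= Hh gr g0 _ e] _]] := L_split x.
pose A : set L := [set v | exists2 s : seq (weight H * L),
  {in s, forall p, p.1.1 <> 0 /\ wvec p.1 p.2} & v = \sum_(p <- s) p.2].
have sA : subspace A.
  apply/subspaceP; split; first by exists [::]; rewrite ?big_nil.
  move=> k u v [s hs ->] [t ht ->].
  exists ([seq (p.1, k *: p.2) | p <- s] ++ t).
    move=> p; rewrite mem_cat => /orP[/mapP[q /hs [q0 wq] ->]|/ht //].
    by split=> //; apply: wvecZ.
  by rewrite big_cat big_map /= scaler_sumr.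
have : A (\sum_(f \in root_set H) g f).
  apply: fsum_subspace => // f; have [rf|nf] := pselect (root_set H f); last first.
    by rewrite g0 //; apply: subspace0.
  have := gr _ rf; have [sf f0 _] := rf.
  have [y [z [hy hz ->]]] := parity_split (g f) => r.
  have [ry rz] := @root_space_parity _ _ _ f 0 y z hy ltac:(by rewrite add0r) r.
  exists [:: ((f, 0), y); ((f, 1), z)]; last by rewrite big_cons big_seq1.
  by move=> p; rewrite !inE => /orP[] /eqP ->; split.
case=> s hs es; rewrite es in e.
have [k wk] : exists k, w = (0, k) by exists w.2; rewrite [LHS]surjective_pairing w0.
rewrite {w w0}wk in wx.
have [y [z [hy hz eh]]] : exists y z, [/\ homog k y, homog (k + 1) z & h = y + z].
  have [y [z [hy hz ->]]] := parity_split h.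
  case: (Z2_cases k) => ->; first by exists y, z; rewrite add0r.
  exists z, y; split=> //; last by rewrite addrC.
  by have -> : 1 + 1 = 0 :> 'Z_2 by apply: val_inj.
have [Hy Hz] : mas_set H y /\ mas_set H z.
  by apply: (graded_comp mas_graded hy hz); rewrite -eh.
suff : x - y = 0 by move/eqP; rewrite subr_eq0 => /eqP ->.
apply: (@wvec_separation0 (0, k) _
  (((0, k + 1), - z) :: [seq (p.1, - p.2) | p <- s])).
- move=> p; rewrite inE => /orP[/eqP ->|/mapP[q /hs[q0 wq] ->]] /=.
    split; last by rewrite -scaleN1r; apply/wvecZ/mas_wvec.
    by case; case: (Z2_cases k) => ->.
  split; last by rewrite -scaleN1r; apply: wvecZ.
  by move=> e'; apply: q0; rewrite e'.
- by apply: wvecD => //; rewrite -scaleN1r; apply/wvecZ/mas_wvec.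
rewrite big_cons big_map /= sumrN e eh.
by rewrite -(addrA y) [y + _]addrC addrK -opprD subrr.
Qed.

Lemma wvec_root_set w x : wvec w x -> w.1 <> 0 -> x <> 0 -> root_set H w.1.
Proof.
move=> [sw rx hx] w0 x0; split=> // e; apply: x0.
by have : [set 0] x by rewrite -e.
Qed.

Lemma wvec_line w x y : w.1 <> 0 -> wvec w x -> x <> 0 -> wvec w y ->
  exists k, y = k *: x.
Proof.
move=> w0 wx x0 wy; have rw := wvec_root_set wx w0 x0.
have mem z : wvec w z -> root_space_par w.1 w.2 z by case.
case: (L_max_length w.2 rw) => -[e [_ eA]].
  have := mem _ wx; rewrite eA => -[c _]; rewrite big_ord0 => e0.
  by case: x0.
have := mem _ wx; rewrite eA => -[c _]; rewrite big_ord1 => ex.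
have := mem _ wy; rewrite eA => -[c' _]; rewrite big_ord1 => ey.
have c0 : c 0 0 != 0.
  by apply/eqP => c0; apply: x0; rewrite -ex c0 scale0r.
by exists (c' 0 0 / c 0 0); rewrite -ex -ey scalerA divfK.
Qed.

(** In a sum of weight vectors lying in [J], two summands of the same weight are
    merged; a summand of a weight that occurs once lies in [J] by separation. *)
Lemma wvec_ideal_span J v : ideal J -> J v ->
  lin_span [set x | J x /\ exists w, wvec w x] v.
Proof.
move=> iJ; have [s hs ->] := wvec_sum v.
move: {2}(size s) (leqnn (size s)) hs => n.
elim: n s => [|n IHn] [|p s] //= sn hs; rewrite ?big_nil //.
1,2: by move=> _; apply: subspace0; apply: subspace_lin_span.
rewrite big_cons => Jv; have wp := hs p (mem_head _ _).
have hs' : {in s, forall p, wvec p.1 p.2} by move=> q qs; apply: hs; rewrite inE qs orbT.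
have [ps|nps] := boolP (p.1 \in [seq q.1 | q <- s]).
  case/mapP: ps => q qs e; have eqs := big_rem q qs.
  rewrite eqs addrA in Jv *.
  have := IHn ((q.1, p.2 + q.2) :: rem q s); rewrite big_cons; apply=> //.
    by rewrite /= size_rem //; case: (s) qs sn.
  move=> r; rewrite inE => /orP[/eqP -> /=|/mem_rem]; last exact: hs'.
  by apply: wvecD; [rewrite -e|apply: hs'].
have Jp : J p.2.
  apply: (@wvec_separation _ _ _ J p.1 (ideal_graded iJ) _ s) => //.
    by move=> h x; apply: idealMr.
  move=> q qs; split; last exact: hs'.
  by move=> e; case/negP: nps; rewrite -e; apply: map_f.
apply: (subspaceD (subspace_lin_span _)).
  by apply: sub_lin_span; split=> //; exists p.1.
apply: IHn => //; apply: (subspace_addIl (ideal_subspace iJ) Jp).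
by rewrite addrC.
Qed.

End Split.

(** * Weights in and off the kernel, and their chains *)

Section Roots.
Context {K : fieldType} {L : leibnizSuperType K} {H : max_abelian_subalg L}.
Implicit Types (x y z v : L) (C J : set L) (a b c d w : weight H) (k : root_kind).

Local Notation I := (@lie_kernel K L).

Definition is_weight k w : Prop := roots_par k w.2 w.1.

Lemma is_weight_root k w : is_weight k w -> root_set H w.1.
Proof. by case: k => -[]. Qed.

Lemma is_weight_neq0 k w : is_weight k w -> w.1 <> 0.
Proof. by move/is_weight_root => []. Qed.

Lemma is_weight_scalar k w : is_weight k w -> scalar w.1.
Proof. by move/is_weight_root => []. Qed.

Lemma subspace_wvec w : subspace (root_space_par w.1 w.2).
Proof.
apply/subspaceP; split.
  by split; [apply: subspace0 (subspace_root_space _)|apply: subspace0 (homog_sub _)].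
move=> k u v [ru hu] [rv hv]; split.
  apply: subspaceD (subspace_root_space _) _ rv.
  exact: subspaceZ (subspace_root_space _) ru.
exact: subspaceD (homog_sub _) (subspaceZ _ (homog_sub _) hu) hv.
Qed.

Lemma roots_kind_weight k (f : even_part H -> K) :
  roots_kind H k f -> exists i, is_weight k (f, i).
Proof. by case=> h; [exists 0|exists 1]. Qed.

Lemma weight_roots_kind k w : is_weight k w -> roots_kind H k w.1.
Proof.
by rewrite /is_weight; case: (Z2_cases w.2) => ->; [left|right].
Qed.

Lemma in_weight_intro w x :
  wvec w x -> w.1 <> 0 -> I x -> x <> 0 -> is_weight InKernel w.
Proof.
move=> wx w0 Ix x0; split; first exact: wvec_root_set wx w0 x0.
move=> e; apply: x0; have : [set 0] x by rewrite -e; case: wx.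
by [].
Qed.

Lemma in_weight_ex w : is_weight InKernel w -> exists x, [/\ wvec w x, I x & x <> 0].
Proof.
move=> h; have sw := is_weight_scalar h; have [rw ne] := h.
apply: contrapT => nex; apply: ne; apply/seteqP; split=> x /=.
  case=> -[Ix hx] [rx _]; apply: contrapT => x0; apply: nex; exists x; split=> //.
move=> ->; have [r0 h0] := subspace0 (subspace_wvec w).
by do !split=> //; apply: subspace0 (ideal_subspace ideal_lie_kernel).
Qed.

Lemma off_weight_ex w : is_weight OffKernel w -> exists2 x, wvec w x & ~ I x.
Proof.
move=> h; have sw := is_weight_scalar h; have [rw ne e] := h.
have [x [rx hx] x0] := not_set0_ex (subspace_wvec w) ne.
exists x => // Ix; apply: x0; have : [set 0] x by rewrite -e.
by [].
Qed.

Lemma off_weight_kernel0 w x : is_weight OffKernel w -> wvec w x -> I x -> x = 0.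
Proof. by move=> [rw _ e] [_ rx hx] Ix; have : [set 0] x by rewrite -e. Qed.

Section MaxLength.
Hypothesis L_split : is_split H.
Hypothesis L_max_length : is_maximal_length H.

Lemma off_weight_intro w x : wvec w x -> w.1 <> 0 -> ~ I x -> is_weight OffKernel w.
Proof.
move=> wx w0 nIx.
have x0 : x <> 0.
  by move=> e; apply: nIx; rewrite e; apply: subspace0 (ideal_subspace ideal_lie_kernel).
have rw := wvec_root_set wx w0 x0.
split=> //; first by move=> e; apply: x0; have : [set 0] x by rewrite -e; case: wx.
apply/seteqP; split=> y /=; last first.
  move=> ->; have [r0 h0] := subspace0 (subspace_wvec w).
  by do !split=> //; apply: subspace0 (ideal_subspace ideal_lie_kernel).
case=> -[Iy hy] [ry _]; have [|t e] := wvec_line L_max_length w0 wx x0 (y := y).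
  by split=> //; case: wx.
have [t0|t0] := eqVneq t 0; first by rewrite e t0 scale0r.
by case: nIx; apply: (subspaceZI (ideal_subspace ideal_lie_kernel) t0); rewrite -e.
Qed.

Lemma weight_mem J w x y : subspace J -> w.1 <> 0 -> wvec w x -> x <> 0 -> J x ->
  wvec w y -> J y.
Proof.
move=> sJ w0 wx x0 Jx wy; have [t ->] := wvec_line L_max_length w0 wx x0 wy.
exact: subspaceZ.
Qed.

End MaxLength.

Lemma lie_annihilator_intro x :
  (forall w y, root_set H w.1 -> ~ roots_kind H InKernel w.1 -> wvec w y ->
    x ** y = 0 /\ y ** x = 0) -> lie_annihilator H x.
Proof.
move=> x0 f rf nf; have sf : scalar f by case: rf.
have main y : root_space f y -> x ** y = 0 /\ y ** x = 0.
  have [y0 [y1 [k0 k1 ->]]] := parity_split y => r.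
  have [r0 r1] := @root_space_parity _ _ _ f 0 y0 y1 k0 ltac:(by rewrite add0r) r.
  have [a1 a2] := x0 (f, 0) y0 rf nf (And3 sf r0 k0).
  have [a3 a4] := x0 (f, 1) y1 rf nf (And3 sf r1 k1).
  by rewrite brDl brDr a1 a2 a3 a4 !addr0.
apply/seteqP; split=> v /=.
  move=> [u uA [t tB <-]]; have -> : u = 0.
    suff : [set 0] u by [].
    move: uA; apply: lin_span_le; first exact: subspace_set0.
    by move=> _ [_ -> [y ry <-]] /=; case: (main _ ry).
  have -> : t = 0.
    suff : [set 0] t by [].
    move: tB; apply: lin_span_le; first exact: subspace_set0.
    by move=> _ [y ry [_ -> <-]] /=; case: (main _ ry).
  by rewrite addr0.
move=> ->; exists 0; first exact: subspace0 (subspace_lin_span _).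
by exists 0; rewrite ?addr0 //; exact: subspace0 (subspace_lin_span _).
Qed.

(** The products of [x] with weight vectors are weight vectors of [J] with the
    same root, so that [x] lies in the Lie annihilator. *)
Lemma ideal_mas0 J x : graded_subspace (mas_set H) -> lie_annihilator H = [set 0] ->
  ideal J ->
  (forall w y, J y -> wvec w y -> root_set H w.1 -> ~ roots_kind H InKernel w.1 -> y = 0) ->
  J x -> mas_set H x -> x = 0.
Proof.
move=> gH Z0 iJ J0 Jx Hx; suff : [set 0] x by [].
rewrite -Z0; apply: lie_annihilator_intro => w y rw nw wy.
have [x0 [x1 [h0 h1 e]]] := parity_split x.
have [Jx0 Jx1] : J x0 /\ J x1.
  by apply: (@graded_comp _ _ _ 0 x0 x1 (ideal_graded iJ)) => //; rewrite ?add0r // -e.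
have [Hx0 Hx1] : mas_set H x0 /\ mas_set H x1.
  by apply: (@graded_comp _ _ _ 0 x0 x1 gH) => //; rewrite ?add0r // -e.
have aux i z : mas_set H z -> homog i z -> J z -> z ** y = 0 /\ y ** z = 0.
  move=> Hz hz Jz; have wz : wvec ((0, i) : weight H) z by apply: mas_wvec.
  split.
    apply: (J0 _ _ (idealMr iJ _ Jz) (wvec_br wz wy)); by rewrite /= add0r.
  apply: (J0 _ _ (idealMl iJ _ Jz) (wvec_br wy wz)); by rewrite /= addr0.
have [a1 a2] := aux _ _ Hx0 h0 Jx0; have [a3 a4] := aux _ _ Hx1 h1 Jx1.
by rewrite e brDl brDr a1 a2 a3 a4 !addr0.
Qed.

(** The chains of the connection relation, with roots and parities added
    together. *)
Inductive reach k a : weight H -> Prop :=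
| reach_refl : reach k a a
| reach_step b d : reach k a b -> is_weight OffKernel d -> is_weight k (b + d) ->
    reach k a (b + d).

Lemma reach_trans k a b c : reach k a b -> reach k b c -> reach k a c.
Proof. by move=> ab; elim=> // *; apply: reach_step. Qed.

Lemma reach_weight k a b : is_weight k a -> reach k a b -> is_weight k b.
Proof. by move=> wa; case. Qed.

Lemma reach1 k a d : is_weight OffKernel d -> is_weight k (a + d) -> reach k a (a + d).
Proof. by move=> wd wad; apply: reach_step => //; apply: reach_refl. Qed.

Lemma reach_connected k a b :
  reach k a b -> offK_connected k a.2 a.1 b.2 b.1.
Proof.
move=> ab; right; elim: ab => [|c d ac [n [r [p [[n0 [r1 p1]] h1 h2 h3 h4]]]] wd wcd].
  exists 1%N, (fun=> a.1), (fun=> a.2); split=> //; try by move=> [|[|]].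
    exact: big_nat1.
  exact: big_nat1.
pose r' l := if l == n.+1 then d.1 else r l.
pose p' l := if l == n.+1 then d.2 else p l.
have er m : (m <= n)%N -> \sum_(1 <= l < m.+1) r' l = \sum_(1 <= l < m.+1) r l.
  move=> mn; apply: eq_big_nat => l /andP[_ lm]; rewrite /r'.
  by rewrite ltn_eqF // ltnS; apply: leq_trans mn.
have ep m : (m <= n)%N -> \sum_(1 <= l < m.+1) p' l = \sum_(1 <= l < m.+1) p l.
  move=> mn; apply: eq_big_nat => l /andP[_ lm]; rewrite /p'.
  by rewrite ltn_eqF // ltnS; apply: leq_trans mn.
have sr : \sum_(1 <= l < n.+2) r' l = (c + d).1.
  by rewrite big_nat_recr //= er // h3 /r' eqxx.
have sp : \sum_(1 <= l < n.+2) p' l = (c + d).2.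
  by rewrite big_nat_recr //= ep // h4 /p' eqxx.
exists n.+1, r', p'; split=> //.
- by rewrite /r' /p' ltn_eqF.
- move=> m /andP[m2]; rewrite leq_eqVlt /r' /p' => /orP[/eqP ->|mn].
    by rewrite eqxx.
  by rewrite (ltn_eqF mn); apply: h1; rewrite m2.
- move=> m /andP[m2]; rewrite leq_eqVlt => /orP[/eqP ->|mn].
    by rewrite sr sp.
  by rewrite er // ep //; apply: h2; rewrite m2.
Qed.

Lemma connected_reach k a b : offK_connected k a.2 a.1 b.2 b.1 ->
  (b.1 = a.1 \/ b.1 = - a.1) \/ reach k a b.
Proof.
case=> [|[n [r [p [[n0 [r1 p1]] h1 h2 h3 h4]]]]]; [by left|right].
suff main m : (1 <= m <= n)%N ->
    reach k a (\sum_(1 <= l < m.+1) r l, \sum_(1 <= l < m.+1) p l).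
  by have := main n; rewrite n0 leqnn h3 h4 -surjective_pairing; apply.
elim: m => // -[_ _|m IHm].
  by rewrite !big_nat1 r1 p1 -surjective_pairing; apply: reach_refl.
move=> mn.
have e : (\sum_(1 <= l < m.+3) r l, \sum_(1 <= l < m.+3) p l) =
    ((\sum_(1 <= l < m.+2) r l, \sum_(1 <= l < m.+2) p l) : weight H) + (r m.+2, p m.+2).
  by congr (_, _); rewrite big_nat_recr.
rewrite e; apply: reach_step; last by rewrite -e; apply: h2.
  by apply: IHm; case/andP: mn => _ /ltnW.
exact: h1.
Qed.

End Roots.

Arguments is_weight : simpl never.

(** * Connected roots make the superalgebra simple *)

Lemma card_gt2_avoid (T : Type) (A : set T) (f g : T) :
  `I_3 #<= A -> exists h, [/\ A h, h <> f & h <> g].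
Proof.
move/card_leP => [F].
have lt n : (n < 3)%N -> n \in `I_3 by move=> n3; rewrite in_setE.
pose e (i : 'I_3) := F (SigSub (lt i (ltn_ord i))).
have e_inj i j : set_val (e i) = set_val (e j) -> i = j.
  move/val_inj => eij; apply: ord_inj.
  by have := @inj _ _ _ F _ _ (mem_setT _) (mem_setT _) eij => -[].
have eA i : A (set_val (e i)) by apply: set_mem; apply: valP.
apply: contrapT => nex.
have fg i : set_val (e i) = f \/ set_val (e i) = g.
  apply: contrapT => n; apply: nex; exists (set_val (e i)); split=> // E.
    by apply: n; left.
  by apply: n; right.
case: (fg 0) (fg 1) (fg (inord 2)) => e0 [] e1 [] e2.
all: by [have := etrans e0 (esym e1) => /e_inj|have := etrans e0 (esym e2) => /e_inj /(congr1 val); rewrite /= inordK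
  |have := etrans e1 (esym e2) => /e_inj /(congr1 val); rewrite /= inordK].
Qed.

Section Core.
Context {K : fieldType} {L : leibnizSuperType K} {H : max_abelian_subalg L}.
Hypothesis L_split : is_split H.
Hypothesis L_max_length : is_maximal_length H.
Hypothesis H_sum : (H : set L) =
       lin_span (\bigcup_(b in root_set H)
                   bracket_set (root_space b) (root_space (- b))).
Hypothesis Z_Lie_0 : lie_annihilator H = [set 0].
Hypothesis L_root_mult : is_root_multiplicative H.
Implicit Types (x y z v : L) (C J : set L) (a b c d w : weight H) (k : root_kind).

Local Notation I := (@lie_kernel K L).
Local Notation Off := (is_weight OffKernel).

Let sI : subspace I := ideal_subspace ideal_lie_kernel.

Lemma kernel0 : I 0. Proof. exact: subspace0. Qed.

Lemma notin_kernel_neq0 x : ~ I x -> x <> 0.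
Proof. by move=> nI e; apply: nI; rewrite e; apply: kernel0. Qed.

Lemma kernel_mas0 x : I x -> mas_set H x -> x = 0.
Proof.
apply: (ideal_mas0 (mas_graded (H := H)) Z_Lie_0 ideal_lie_kernel).
move=> w y Iy wy [_ w0 _] nk; apply: contrapT => y0; apply: nk.
exact: weight_roots_kind (in_weight_intro wy w0 Iy y0).
Qed.

Lemma kernel_weight w x : wvec w x -> I x -> x <> 0 -> is_weight InKernel w.
Proof.
move=> wx Ix x0; apply: (in_weight_intro wx _ Ix x0) => w0.
by apply: x0; apply: kernel_mas0 Ix _; apply: wvec0_mas wx w0.
Qed.

(** In H and in off-kernel weight spaces, congruence modulo the kernel is
    equality: computations modulo the kernel become exact there. *)
Lemma kernel_wvec0 w x : w.1 = 0 \/ Off w -> wvec w x -> I x -> x = 0.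
Proof.
case=> [w0|wO] wx Ix; last exact: off_weight_kernel0 wO wx Ix.
by apply: kernel_mas0 => //; apply: wvec0_mas wx w0.
Qed.

Lemma root_par_wvec w x : scalar w.1 -> root_space_par w.1 w.2 x -> wvec w x.
Proof. by move=> sw []. Qed.

Lemma br_neq0_line a b x y : a.1 <> 0 -> b.1 <> 0 -> 
  bracket_set (root_space_par a.1 a.2) (root_space_par b.1 b.2) <> [set 0] ->
  wvec a x -> x <> 0 -> wvec b y -> y <> 0 -> x ** y <> 0.
Proof.
move=> a0 b0 /bracket_set_neq0[x' [y' [ax by' ne]]] wx x0 wy y0 e.
have wx' : wvec a x' by case: wx => sa _ _; apply: root_par_wvec.
have wy' : wvec b y' by case: wy => sb _ _; apply: root_par_wvec.
have [s ex] := wvec_line L_max_length a0 wx x0 wx'.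
have [t ey] := wvec_line L_max_length b0 wy y0 wy'.
by apply: ne; rewrite ex ey brZl brZr e !scaler0.
Qed.

Lemma off_mult a b x y : Off a -> Off b -> root_set H (a + b).1 ->
  wvec a x -> x <> 0 -> wvec b y -> y <> 0 -> x ** y <> 0.
Proof.
move=> Oa Ob rab; apply: br_neq0_line; try exact: is_weight_neq0.
  exact: is_weight_neq0 Oa.
  exact: is_weight_neq0 Ob.
by case: L_root_mult => h _; apply: h.
Qed.

Lemma weight_mult k a b x y : is_weight k a -> Off b -> is_weight k (a + b) ->
  wvec a x -> x <> 0 -> wvec b y -> y <> 0 -> x ** y <> 0.
Proof.
case: k => ka Ob kab; last exact: off_mult (is_weight_root kab).
apply: br_neq0_line; [exact: is_weight_neq0 ka|exact: is_weight_neq0 Ob|].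
case: L_root_mult => _ h; apply: h => //.
by rewrite addrC; apply: weight_roots_kind kab.
Qed.

Lemma weight_ex k w : is_weight k w -> exists2 x, wvec w x & x <> 0.
Proof.
case: k => [/in_weight_ex[x [wx _ x0]]|/off_weight_ex[x wx nIx]]; exists x => //.
exact: notin_kernel_neq0.
Qed.

Definition contains_weight J w := forall x, wvec w x -> J x.

Lemma reach_mem J k a b : ideal J -> is_weight k a -> reach k a b ->
  contains_weight J a -> contains_weight J b.
Proof.
move=> iJ ka; elim=> // c d ac IHc Od kcd /IHc Jc x wx.
have [y wy y0] := weight_ex (reach_weight ka ac).
have [z wz z0] := weight_ex Od.
have yz0 := weight_mult (reach_weight ka ac) Od kcd wy y0 wz z0.
apply: (weight_mem L_max_length (ideal_subspace iJ) (is_weight_neq0 kcd) (wvec_br wy wz) yz0) wx.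
by apply: idealMr => //; apply: Jc.
Qed.

(** A third root [c] links [a] to [b] even when [b] has the root [a] or [- a],
    a case in which connectedness alone yields no chain. *)
Lemma connected_mem J k a b : `I_3 #<= roots_kind H k -> all_offK_connected H k ->
  ideal J -> is_weight k a -> contains_weight J a -> is_weight k b -> contains_weight J b.
Proof.
move=> card conn iJ ka Ja kb.
have link c d : is_weight k c -> is_weight k d -> d.1 <> c.1 -> d.1 <> - c.1 ->
    contains_weight J c -> contains_weight J d.
  move=> kc kd n1 n2; have := conn _ _ _ _ kc kd.
  by case/connected_reach => [[]//|cd]; apply: reach_mem cd.
have [/orP|] := boolP ((b.1 == a.1) || (b.1 == - a.1)); last first.
  by rewrite negb_or => /andP[/eqP n1 /eqP n2]; apply: (link a).
move=> e; have [f [kf n1 n2]] := card_gt2_avoid a.1 (- a.1) card.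
have [i kc] := roots_kind_weight kf.
have Jc : contains_weight J (f, i) by apply: (link a).
apply: (link (f, i)) => //=.
  by case: e => /eqP -> E; [apply: n1|apply: n2].
by case: e => /eqP -> E; [apply: n2; rewrite E opprK|apply: n1; rewrite -[LHS]opprK -E opprK].
Qed.

Lemma root_ne_ex w : w.1 <> 0 -> exists h : even_part H, w.1 h != 0.
Proof.
move=> w0; apply: contrapT => nex; apply: w0; apply/funext => h.
by apply: contrapT => /eqP n; apply: nex; exists h.
Qed.

(* A root vector is a multiple of its product with an even element of H. *)
Lemma mas_ideal_full J : ideal J -> mas_set H `<=` J -> J = setT.
Proof.
move=> iJ HJ; apply/seteqP; split=> // v _.
apply: (wvec_gen L_split (ideal_subspace iJ)) => w x wx.
have [w0|w0] := pselect (w.1 = 0); first by apply/HJ/wvec0_mas/w0.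
have [h h0] := root_ne_ex w0.
apply: (subspaceZI (ideal_subspace iJ) h0); have [_ <- _] := wx.
by apply: idealMl => //; apply: HJ; apply: even_part_mem.
Qed.

(** H is spanned by products of opposite root vectors.  If the second factor is
    in the kernel the product is zero, otherwise it is in [J]. *)
Lemma off_ideal_full J : ideal J -> (forall w, Off w -> contains_weight J w) -> J = setT.
Proof.
move=> iJ JO; apply: mas_ideal_full => //; rewrite H_sum.
apply: (lin_span_le (ideal_subspace iJ)) => v [f rf].
apply: (lin_span_le (ideal_subspace iJ)) => _ [x rx [y ry <-]].
have [y0 [y1 [h0 h1 e]]] := parity_split y; rewrite e in ry *.
have [r0 r1] := @root_space_parity _ _ _ (- f) 0 y0 y1 h0 ltac:(by rewrite add0r) ry.
have sf : scalar (- f) by case: rf => sf _ _; apply: scalar_funN.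
have f0 : - f <> 0 by case: rf => _ f0 _ /eqP; rewrite oppr_eq0 => /eqP.
have main i z : root_space (- f) z -> homog i z -> J (x ** z).
  move=> rz hz; have wz : wvec ((- f, i) : weight H) z by [].
  have [Iz|nIz] := pselect (I z).
    by rewrite kernel_right //; apply: subspace0 (ideal_subspace iJ).
  apply: idealMl => //; apply: (JO _ _ _ wz).
  exact: off_weight_intro wz f0 nIz.
by rewrite brDr; apply: subspaceD (ideal_subspace iJ) _ _; apply: main; eassumption.
Qed.

(** An ideal containing no off-kernel weight space meets H inside the Lie
    annihilator, hence lies in the kernel, where the connection of the roots of
    the kernel applies. *)
Lemma connected_simple : `I_3 #<= roots_kind H OffKernel -> `I_3 #<= roots_kind H InKernel ->
  all_offK_connected H InKernel -> all_offK_connected H OffKernel -> is_simple L.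
Proof.
move=> cO cI connI connO; split.
  have [f [/roots_kind_weight[i kf] _ _]] := card_gt2_avoid 0 0 cO.
  have [x wx x0] := weight_ex kf.
  have [h h0] := root_ne_ex (is_weight_neq0 kf).
  move=> e; have : [set 0] (x ** val h) by rewrite -e; apply: bracket_setE.
  have [_ -> _] := wx => /= /eqP; rewrite scaler_eq0 (negPf h0) /= => /eqP; exact: x0.
move=> J iJ; have sJ := ideal_subspace iJ.
have [[w [x [Ow wx Jx nIx]]]|nO] := pselect (exists w x, [/\ Off w, wvec w x, J x & ~ I x]).
  apply: Or33; apply: off_ideal_full => // b Ob.
  apply: (connected_mem cO connO iJ Ow) => // y.
  exact: (weight_mem L_max_length sJ (is_weight_neq0 Ow) wx (notin_kernel_neq0 nIx) Jx).
have JI w x : J x -> wvec w x -> w.1 <> 0 -> I x.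
  move=> Jx wx w0; apply: contrapT => nIx; apply: nO; exists w, x; split=> //.
  exact: off_weight_intro wx w0 nIx.
have JH x : J x -> mas_set H x -> x = 0.
  apply: (ideal_mas0 (mas_graded (H := H)) Z_Lie_0 iJ).
  move=> w y Jy wy [_ w0 _] nk; apply: contrapT => y0; apply: nk.
  by apply: weight_roots_kind (in_weight_intro wy w0 _ y0); apply: JI wy w0.
have JIn w x : J x -> wvec w x -> x <> 0 -> w.1 <> 0.
  by move=> Jx wx x0 w0; apply: x0; apply: JH => //; apply: wvec0_mas wx w0.
have subJI : J `<=` I.
  move=> v Jv; have := wvec_ideal_span L_split iJ Jv.
  apply: (lin_span_le sI) => x [Jx [w wx]].
  have [->|/eqP x0] := eqVneq x 0; first exact: kernel0.
  by apply: (JI w x) => //; apply: (JIn w x).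
have [J0|nJ0] := pselect (J = [set 0]); first by apply: Or31.
apply: Or32; apply/seteqP; split=> // v Iv.
have := wvec_ideal_span L_split ideal_lie_kernel Iv.
apply: (lin_span_le sJ) => x [Ix [w wx]].
have [->|/eqP x0] := eqVneq x 0; first exact: subspace0.
have [[u [y [Jy uy y0]]]|nex] := pselect (exists (u : weight H) y, [/\ J y, wvec u y & y <> 0]).
  have u0 := JIn _ _ Jy uy y0; have ku := in_weight_intro uy u0 (JI _ _ Jy uy u0) y0.
  apply: (connected_mem cI connI iJ ku) (kernel_weight wx Ix x0) _ wx => z.
  exact: (weight_mem L_max_length sJ u0 uy y0 Jy).
case: nJ0; apply/seteqP; split=> [|y ->]; last exact: subspace0.
suff : J `<=` [set 0] by apply.
move=> y Jy; have := wvec_ideal_span L_split iJ Jy.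
apply: (lin_span_le (B := [set 0])); first exact: subspace_set0.
move=> z [Jz [u uz]] /=.
by apply: contrapT => z0; apply: nex; exists u, z.
Qed.

End Core.

(** * Words in root vectors *)

Section Words.
Context {K : fieldType} {L : leibnizSuperType K} {H : max_abelian_subalg L}.
Hypothesis L_split : is_split H.
Hypothesis L_max_length : is_maximal_length H.
Hypothesis H_sum : (H : set L) =
       lin_span (\bigcup_(b in root_set H)
                   bracket_set (root_space b) (root_space (- b))).
Hypothesis Z_Lie_0 : lie_annihilator H = [set 0].
Implicit Types (x y z v : L) (C J : set L) (a b c d w : weight H) (k : root_kind).
Implicit Types (s t : seq (weight H * L)) (p : weight H * L).

Local Notation I := (@lie_kernel K L).
Local Notation Off := (is_weight OffKernel).

Let iI : ideal I := ideal_lie_kernel.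
Let sI : subspace I := ideal_subspace ideal_lie_kernel.

Fixpoint root_word s : Prop :=
  if s is p :: s' then [/\ wvec p.1 p.2, p.1.1 <> 0 & root_word s'] else True.

Definition word_act x s : L := foldl (fun y p => y ** p.2) x s.
Definition word_weight a s : weight H := foldl (fun c p => c + p.1) a s.

Lemma word_act_cat x s t : word_act x (s ++ t) = word_act (word_act x s) t.
Proof. exact: foldl_cat. Qed.

Lemma word_weight_cat a s t :
  word_weight a (s ++ t) = word_weight (word_weight a s) t.
Proof. exact: foldl_cat. Qed.

Lemma root_word_cat s t : root_word (s ++ t) <-> root_word s /\ root_word t.
Proof.
elim: s => [|p s IHs] /=; first by split=> [rt|[_ rt]] //; split.
split=> [[wp p0 /IHs[rs rt]]|[[wp p0 rs] rt]]; first by split; first split.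
by split=> //; apply/IHs.
Qed.

Lemma word_actD x y s : word_act (x + y) s = word_act x s + word_act y s.
Proof. by elim: s x y => [|p s IHs] x y //=; rewrite brDl IHs. Qed.

Lemma word_actZ (k : K) x s : word_act (k *: x) s = k *: word_act x s.
Proof. by elim: s x => [|p s IHs] x //=; rewrite brZl IHs. Qed.

Lemma word_act0 s : word_act 0 s = 0.
Proof. by elim: s => [|p s IHs] //=; rewrite br0l. Qed.

Lemma word_act_ideal J x s : ideal J -> J x -> J (word_act x s).
Proof. by move=> iJ; elim: s x => [|p s IHs] x //= Jx; apply: IHs; apply: idealMr. Qed.

Lemma wvec_word a x s : wvec a x -> root_word s -> wvec (word_weight a s) (word_act x s).
Proof.
by elim: s a x => [|p s IHs] a x //= wx [wp _ rs]; apply: IHs rs; apply: wvec_br.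
Qed.

Definition word_span x C : set L :=
  lin_span ([set u | exists2 s, root_word s & u = word_act x s] `|` C).

(** H is spanned by products of opposite root vectors, so the Leibniz identity
    turns right multiplications by H into words.  Left multiplications agree up
    to sign with right ones modulo the kernel, and vanish on the kernel. *)
Lemma word_span_ideal a x C : wvec a x -> ideal C -> I `<=` C \/ I x ->
  ideal (word_span x C).
Proof.
move=> wx iC hC; have sM : subspace (word_span x C) := subspace_lin_span _.
have MC : C `<=` word_span x C by move=> u Cu; apply: sub_lin_span; right.
have Mw s : root_word s -> word_span x C (word_act x s).
  by move=> rs; apply: sub_lin_span; left; exists s.
have br_word s w y : root_word s -> wvec w y -> w.1 <> 0 ->
    word_span x C (word_act x s ** y).
  move=> rs wy w0; have := Mw (s ++ [:: (w, y)]); rewrite word_act_cat; apply.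
  by apply/root_word_cat; split.
have right y s : root_word s -> word_span x C (word_act x s ** y).
  move=> rs; pose A : set L := [set y | word_span x C (word_act x s ** y)].
  suff : A y by [].
  have sA : subspace A.
    apply/subspaceP; split; first by rewrite /A /= br0r; apply: (subspace0 sM).
    by move=> k u v Au Av; rewrite /A /= brDr brZr; apply: (subspaceD sM) => //; apply: (subspaceZ _ sM).
  apply: (wvec_gen L_split sA) => w {}y wy.
  have [w0|] := pselect (w.1 = 0); last exact: br_word.
  have := wvec0_mas L_split wy w0; rewrite H_sum; apply: (lin_span_le sA) => v [f rf].
  apply: (lin_span_le sA) => _ [u ru [t rt <-]].
  have [sf f0 _] := rf.
  have nf0 : - f <> 0 by move/eqP; rewrite oppr_eq0 => /eqP.
  have [u0 [u1 [hu0 hu1 e]]] := parity_split u; rewrite e in ru *.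
  have [ru0 ru1] := @root_space_parity _ _ _ f 0 u0 u1 hu0 ltac:(by rewrite add0r) ru.
  have [t0 [t1 [ht0 ht1 et]]] := parity_split t; rewrite et in rt *.
  have [rt0 rt1] := @root_space_parity _ _ _ (- f) 0 t0 t1 ht0 ltac:(by rewrite add0r) rt.
  have main i j g q : homog i g -> homog j q -> root_space f g -> root_space (- f) q ->
      A (g ** q).
    move=> hg hq rg rq; have wg : wvec ((f, i) : weight H) g by [].
    have wq : wvec ((- f, j) : weight H) q by split=> //; apply: scalar_funN.
    rewrite /A /= (wvec_leibniz (wvec_word wx rs) wg wq).
    have wrd (u1' : weight H) v1 (u2 : weight H) v2 : wvec u1' v1 -> u1'.1 <> 0 -> wvec u2 v2 -> u2.1 <> 0 ->
        word_span x C (word_act x s ** v1 ** v2).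
      move=> w1 n1 w2 n2; have := Mw (s ++ [:: (u1', v1); (u2, v2)]).
      by rewrite word_act_cat; apply; apply/root_word_cat.
    apply: (subspaceB sM); first exact: wrd wg _ wq _.
    by apply: (subspaceZ _ sM); apply: wrd wq _ wg _.
  by rewrite brDl !brDr; apply: (subspaceD sA); apply: (subspaceD sA);
    apply: main; eassumption.
have Mr u y : word_span x C u -> word_span x C (u ** y).
  pose A : set L := [set u | word_span x C (u ** y)].
  have sA : subspace A.
    apply/subspaceP; split; first by rewrite /A /= br0l; apply: (subspace0 sM).
    by move=> k v t Av At; rewrite /A /= brDl brZl; apply: (subspaceD sM) => //; apply: (subspaceZ _ sM).
  suff : word_span x C `<=` A by apply.
  apply: (lin_span_le sA) => {}u [[s rs ->]|Cu]; first exact: right.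
  by apply: MC; apply: idealMr.
apply: ideal_intro => //.
  apply: graded_intro => // u v hu hv.
  pose A : set L := [set u | exists p q : L, [/\ homog 0 p, homog 1 q, u = p + q,
    word_span x C p & word_span x C q]].
  suff : word_span x C `<=` A.
    move=> sMA /sMA[p [q [hp hq e Mp Mq]]].
    by have [->] := parity_uniq hu hv hp hq e.
  have h00 i := subspace0 (@homog_sub _ L i).
  have sA : subspace A.
    apply/subspaceP; split; first by exists 0, 0; split=> //; rewrite ?addr0 //; exact: subspace0.
    move=> k _ _ [p [q [hp hq -> Mp Mq]]] [p' [q' [hp' hq' -> Mp' Mq']]].
    exists (k *: p + p'), (k *: q + q'); split.
    - by apply: subspaceD (homog_sub _) _ _ => //; apply: subspaceZ (homog_sub _) _.
    - by apply: subspaceD (homog_sub _) _ _ => //; apply: subspaceZ (homog_sub _) _.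
    - by rewrite scalerDr addrACA.
    - by apply: (subspaceD sM) => //; apply: (subspaceZ _ sM).
    - by apply: (subspaceD sM) => //; apply: (subspaceZ _ sM).
  apply: (lin_span_le sA) => t [[s rs ->]|Ct].
    have [_ _] := wvec_word wx rs; have := Mw _ rs.
    move: (word_act x s) => y My; case: (Z2_cases (word_weight a s).2) => -> hy.
      by exists y, 0; split; rewrite ?addr0 //; exact: (subspace0 sM).
    by exists 0, y; split; rewrite ?add0r //; exact: (subspace0 sM).
  have [p [q [hp hq e]]] := parity_split t.
  have [Cp Cq] : C p /\ C q.
    by apply: (@graded_comp _ _ _ 0 p q (ideal_graded iC)); rewrite ?add0r // -e.
  by exists p, q; split=> //; apply: MC.
move=> u y; pose A : set L := [set u | word_span x C (y ** u)].
have sA : subspace A.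
  apply/subspaceP; split; first by rewrite /A /= br0r; apply: (subspace0 sM).
  by move=> k v t Av At; rewrite /A /= brDr brZr; apply: (subspaceD sM) => //; apply: (subspaceZ _ sM).
suff : word_span x C `<=` A by apply.
apply: (lin_span_le sA) => {sA}{}u [[s rs ->]|Cu]; last by apply: MC; apply: idealMl.
rewrite {}/A /=; case: hC => [IC|Ix]; last first.
  by rewrite (kernel_right _ (word_act_ideal s iI Ix)); apply: (subspace0 sM).
pose A : set L := [set y | word_span x C (y ** word_act x s)].
have sA : subspace A.
  apply/subspaceP; split; first by rewrite /A /= br0l; apply: (subspace0 sM).
  by move=> k v t Av At; rewrite /A /= brDl brZl; apply: (subspaceD sM) => //; apply: (subspaceZ _ sM).
apply: (wvec_gen L_split sA) => w {}y wy; rewrite /A /=.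
apply: (subspace_addIl sM _ (MC _ (IC _ (wvec_skew wy (wvec_word wx rs))))).
by apply: (subspaceZ _ sM); apply: right.
Qed.

(** If all words of weight [b] were in [C], then [v] would be a vector of [C] plus
    vectors of weights other than [b], and separation would put it in [C]. *)
Lemma word_extract a x C b v : wvec a x -> ideal C ->
  word_span x C v -> wvec b v -> ~ C v ->
  exists s, [/\ root_word s, word_weight a s = b & ~ C (word_act x s)].
Proof.
move=> wx iC Mv wv nCv; apply: contrapT => nex; apply: nCv.
have sC := ideal_subspace iC.
pose A : set L := [set u | exists2 c, C c & exists2 s,
  {in s, forall p, p.1 <> b /\ wvec p.1 p.2} & u = c + \sum_(p <- s) p.2].
have sA : subspace A.
  apply/subspaceP; split.
    by exists 0; [exact: subspace0|exists [::]; rewrite ?big_nil ?addr0].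
  move=> k _ _ [c Cc [s hs ->]] [d Cd [t ht ->]].
  exists (k *: c + d); first by apply: subspaceD => //; apply: subspaceZ.
  exists ([seq (p.1, k *: p.2) | p <- s] ++ t).
    move=> p; rewrite mem_cat => /orP[/mapP[q /hs[q0 wq] ->]|/ht //].
    by split=> //; apply: wvecZ.
  by rewrite big_cat big_map /= scalerDr scaler_sumr addrACA.
have : A v.
  move: Mv; apply: (lin_span_le sA) => u [[s rs ->]|Cu]; last first.
    by exists u => //; exists [::]; rewrite ?big_nil ?addr0.
  have [e|ne] := pselect (word_weight a s = b).
    exists (word_act x s); first by apply: contrapT => nC; apply: nex; exists s.
    by exists [::]; rewrite ?big_nil ?addr0.
  exists 0; first exact: subspace0.
  exists [:: (word_weight a s, word_act x s)]; last by rewrite big_seq1 add0r.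
  by move=> p; rewrite inE => /eqP ->; split=> //; apply: wvec_word.
case=> c Cc [s hs e].
apply: (@wvec_separation _ _ _ C b (ideal_graded iC) _ [seq (p.1, - p.2) | p <- s]) => //.
- by move=> h u; apply: idealMr.
- move=> p /mapP[q /hs[q0 wq] ->]; split=> //=.
  by rewrite -scaleN1r; apply: wvecZ.
by rewrite big_map /= sumrN e addrK.
Qed.

Lemma off_word_ex a x b : is_simple L -> wvec a x -> ~ I x -> Off b ->
  exists s, [/\ root_word s, word_weight a s = b & ~ I (word_act x s)].
Proof.
move=> [_ simp] wx nIx /off_weight_ex[y wy nIy].
have iM := word_span_ideal wx iI (or_introl (@subset_refl _ I)).
have Mx : word_span x I x by apply: sub_lin_span; left; exists [::].
apply: (word_extract wx iI _ wy nIy).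
case: (simp _ iM) => e; last by rewrite e.
  by case: nIx; have : [set 0] x by [rewrite -e]; move=> /= ->; apply: subspace0.
by case: nIx; rewrite -e.
Qed.

Lemma in_word_ex a x b : is_simple L -> wvec a x -> I x -> x <> 0 ->
  is_weight InKernel b ->
  exists s, [/\ root_word s, word_weight a s = b & word_act x s <> 0].
Proof.
move=> [_ simp] wx Ix x0 /in_weight_ex[y [wy Iy y0]].
have iM := word_span_ideal wx ideal_set0 (or_intror Ix).
have Mx : word_span x [set 0] x by apply: sub_lin_span; left; exists [::].
apply: (word_extract wx ideal_set0 _ wy y0).
case: (simp _ iM) => e; last by rewrite e.
  by case: x0; have : [set 0] x by [rewrite -e].
by rewrite e.
Qed.

(** The partial products are nonzero vectors of the kernel, which meets H in 0:
    none of their weights has root zero. *)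
Lemma in_word_reach a x s : wvec a x -> I x -> root_word s -> word_act x s <> 0 ->
  reach InKernel a (word_weight a s).
Proof.
elim: s a x => [|p s IHs] a x wx Ix /=; first by move=> *; apply: reach_refl.
case=> wp p0 rs ne; have Ixp := idealMr iI p.2 Ix.
apply: reach_trans (IHs _ _ (wvec_br wx wp) Ixp rs ne).
apply: reach1.
  apply: (off_weight_intro L_max_length wp p0) => Ip.
  by apply: ne; rewrite kernel_right // word_act0.
apply: (kernel_weight L_split Z_Lie_0 (wvec_br wx wp) Ixp) => e.
by apply: ne; rewrite e word_act0.
Qed.

Lemma simple_connected_in : is_simple L -> all_offK_connected H InKernel.
Proof.
move=> simp i j f g ka kb; have [x [wx Ix x0]] := in_weight_ex (w := (f, i)) ka.
have [s [rs es ne]] := in_word_ex (b := (g, j)) simp wx Ix x0 kb.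
by have := reach_connected (in_word_reach wx Ix rs ne); rewrite es.
Qed.

End Words.

(** * Chains between different lines *)

Section Lines.
Context {K : fieldType} {L : leibnizSuperType K} {H : max_abelian_subalg L}.
Hypothesis L_split : is_split H.
Hypothesis L_max_length : is_maximal_length H.
Implicit Types (x y z v X D E : L) (a b c d e w : weight H) (k : root_kind).
Implicit Types (s t : seq (weight H * L)) (p : weight H * L).
Implicit Types (f g h : even_part H -> K) (Q : set (even_part H -> K)).

Local Notation I := (@lie_kernel K L).
Local Notation Off := (is_weight OffKernel).

Let iI : ideal I := ideal_lie_kernel.
Let sI : subspace I := ideal_subspace ideal_lie_kernel.

Lemma notin_kernel_add x y : ~ I (x + y) -> ~ I x \/ ~ I y.
Proof.
move=> n; apply: contrapT => /not_orP[/contrapT Ix /contrapT Iy].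
by apply: n; apply: (subspaceD sI).
Qed.

Lemma notin_kernelZ (k : K) x : ~ I (k *: x) -> ~ I x.
Proof. by move=> n Ix; apply: n; apply: (subspaceZ _ sI). Qed.

Lemma notin_kernel_word x s : ~ I (word_act x s) -> ~ I x.
Proof. by move=> n Ix; apply: n; exact: (word_act_ideal s iI Ix). Qed.

Lemma notin_kernel_brr x y : ~ I (x ** y) -> ~ I y.
Proof. by move=> n Iy; apply: n; rewrite kernel_right //; apply: (subspace0 sI). Qed.

Lemma notin_kernel_brl x y : ~ I (x ** y) -> ~ I x.
Proof. by move=> n Ix; apply: n; exact: (idealMr iI y Ix). Qed.

(** Used to distribute letters: [z] acts on one of the two factors of
    [x ** y]. *)
Lemma notin_kernel_leibniz a b c x y z s : wvec a x -> wvec b y -> wvec c z ->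
  ~ I (word_act (x ** y ** z) s) ->
  ~ I (word_act (x ** (y ** z)) s) \/ ~ I (word_act (x ** z ** y) s).
Proof.
move=> wx wy wz; rewrite (wvec_leibniz_l wx wy wz) word_actD word_actZ.
by case/notin_kernel_add; [left|right; apply: notin_kernelZ; eassumption].
Qed.

(** The sum of [d] and of the weights of any subsequence of [s] has a nonzero
    root. *)
Fixpoint avoids d s : Prop :=
  if s is p :: s' then avoids d s' /\ avoids (d + p.1) s' else d.1 <> 0.

Lemma avoids_neq0 d s : avoids d s -> d.1 <> 0.
Proof. by elim: s d => //= p s IHs d [/IHs]. Qed.

Lemma avoids2 d (p1 p2 : weight H * L) : d.1 <> 0 -> d.1 + p2.1.1 <> 0 -> d.1 + p1.1.1 <> 0 ->
  d.1 + p1.1.1 + p2.1.1 <> 0 -> avoids d [:: p1; p2].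
Proof. by do !split. Qed.

(** The main tool to get rid of passages through H: the letters of [s] are
    distributed over the two factors [X] and [E].  The product of [X] with its
    share is a chain, and the last step adds the weight of [E] with its share.
    The weight of [X ** E] itself may have root zero. *)
Lemma split_word_reach d e s X E : wvec d X -> wvec e E -> root_word s ->
  avoids d s -> avoids e s -> (word_weight (d + e) s).1 <> 0 ->
  ~ I (word_act (X ** E) s) -> reach OffKernel d (word_weight (d + e) s).
Proof.
elim: s d e X E => [|p s IHs] d e X E wX wE /=.
  move=> _ d0 e0 de0 nI; have OE := off_weight_intro L_max_length wE e0 (notin_kernel_brr nI).
  by apply: (reach1 OE); exact: (off_weight_intro L_max_length (wvec_br wX wE) de0 nI).
move=> [wp p0 rs] [ad adp] [ae aep] t0 nI.
case: (notin_kernel_leibniz wX wE wp nI) => nI'.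
  have := IHs d (e + p.1) X (E ** p.2) wX (wvec_br wE wp) rs ad aep.
  by rewrite addrA; apply.
have nXp := notin_kernel_word nI'.
have OXp := off_weight_intro L_max_length (wvec_br wX wp) (avoids_neq0 adp) (notin_kernel_brl nXp).
have Op := off_weight_intro L_max_length wp p0 (notin_kernel_brr (notin_kernel_brl nXp)).
apply: reach_trans (reach1 Op OXp) _.
by have := IHs (d + p.1) e (X ** p.2) E (wvec_br wX wp) wE rs adp ae; rewrite addrAC; apply.
Qed.

Section Subgroup.
Variable Q : set (even_part H -> K).
Hypothesis QB : forall f g, Q f -> Q g -> Q (f - g).
Hypothesis Q0 : Q 0.

Fixpoint letters_in s : Prop := if s is p :: s' then Q p.1.1 /\ letters_in s' else True.

Lemma subgroupN f : Q f -> Q (- f).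
Proof. by move=> Qf; rewrite -sub0r; apply: QB. Qed.

Lemma subgroupD f g : Q f -> Q g -> Q (f + g).
Proof. by move=> Qf Qg; rewrite -[g]opprK; apply: QB => //; apply: subgroupN. Qed.

Lemma notin_subgroupD f g : ~ Q f -> Q g -> ~ Q (f + g).
Proof. by move=> nf Qg Qfg; apply: nf; rewrite -[f](addrK g); apply: QB. Qed.

Lemma letters_in_weight a s : Q a.1 -> letters_in s -> Q (word_weight a s).1.
Proof.
elim: s a => //= p s IHs a Qa [Qp Qs]; apply: IHs => //=; exact: subgroupD.
Qed.

Lemma letters_in_avoids d s : ~ Q d.1 -> letters_in s -> avoids d s.
Proof.
elim: s d => [|p s IHs] d nd /=; first by move=> _ e; apply: nd; rewrite e.
by case=> Qp Qs; split; apply: IHs => //=; apply: notin_subgroupD.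
Qed.

Lemma letters_in_rcons s p : letters_in (rcons s p) <-> letters_in s /\ Q p.1.1.
Proof.
elim: s => [|q s IHs] /=; first by split=> [[]|[]].
by split=> [[Qq /IHs[]]|[[Qq Qs] Qp]] //; split=> //; apply/IHs.
Qed.

Lemma letters_split s : letters_in s \/
  exists s1 p s2, [/\ s = s1 ++ p :: s2, letters_in s1 & ~ Q p.1.1].
Proof.
elim: s => [|p s [Qs|[s1 [q [s2 [-> Qs1 nq]]]]]] /=; first by left.
  have [Qp|nQp] := pselect (Q p.1.1); first by left.
  by right; exists [::], p, s.
have [Qp|nQp] := pselect (Q p.1.1); last by right; exists [::], p, (s1 ++ q :: s2).
by right; exists (p :: s1), q, s2.
Qed.

(** A letter outside [Q] can be moved to the front: jumping over a letter of
    [Q], it either commutes past it or absorbs it, and stays outside [Q]. *)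
Lemma outer_letter_first a d x D s t : wvec a x -> wvec d D -> root_word s ->
  root_word t -> letters_in s -> ~ Q d.1 ->
  ~ I (word_act (word_act x s ** D) t) ->
  exists d' D' s', [/\ wvec d' D' /\ ~ Q d'.1, root_word s',
    (size s' <= size s + size t)%N, ~ I (word_act (x ** D') s') &
    word_weight (a + d') s' = word_weight (word_weight a s + d) t].
Proof.
move=> wx; elim/last_ind: s d D t => [|s p IHs] d D t wD.
  by move=> _ rt _ nd nI; exists d, D, t.
rewrite -cats1 => /root_word_cat[rs [wp p0 _]] rt; rewrite cats1.
move=> /letters_in_rcons[Qs Qp] nd; rewrite -cats1 word_act_cat /= word_weight_cat /=.
move=> nI; case: (notin_kernel_leibniz (wvec_word wx rs) wp wD nI) => nI'.
  have npd : ~ Q (p.1 + d).1 by rewrite /= addrC; apply: notin_subgroupD.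
  have [d' [D' [s' [wD' rs' le nI'' ew]]]] := IHs _ _ t (wvec_br wp wD) rs rt Qs npd nI'.
  exists d', D', s'; split=> //; last by rewrite ew addrA.
  by rewrite size_cat; apply: leq_trans le _; rewrite leq_add2r leq_addr.
have [d' [D' [s' [wD' rs' le nI'' ew]]]] :=
  IHs d D (p :: t) wD rs (And3 wp p0 rt) Qs nd nI'.
exists d', D', s'; split=> //; first by rewrite size_cat addn1 addSnnS.
by rewrite ew /= addrAC.
Qed.

End Subgroup.

(** Proportionality over the prime field.  In characteristics 2 and 3 such a line
    holds no root besides a given one and its opposite. *)
Definition same_line f g : Prop := exists m n : int,
  [/\ m%:~R != 0 :> K & forall u : even_part H, m%:~R * g u = n%:~R * f u].

Lemma same_line_refl f : same_line f f.
Proof. by exists 1, 1; rewrite oner_neq0. Qed.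

Lemma same_line0 f : same_line f 0.
Proof.
exists 1, 0; rewrite oner_neq0; split=> // h.
by have -> : (0 : even_part H -> K) h = 0 by []; rewrite mulr0 mul0r.
Qed.

Lemma same_line_trans f g h : same_line f g -> same_line g h -> same_line f h.
Proof.
move=> [m [n [m0 e]]] [m' [n' [m0' e']]]; exists (m * m'), (n * n'); split.
  by rewrite intrM mulf_neq0.
by move=> v; rewrite !intrM -mulrA e' mulrCA e mulrA [n'%:~R * _]mulrC.
Qed.

Lemma same_line_sym f g : g <> 0 -> same_line f g -> same_line g f.
Proof.
move=> g0 [m [n [m0 e]]]; exists n, m; split=> //.
apply/eqP => n0; apply: g0; apply/funext => h; apply/eqP.
by have := e h; rewrite n0 mul0r => /eqP; rewrite mulf_eq0 (negPf m0).
Qed.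

Lemma same_lineB f g h : same_line f g -> same_line f h -> same_line f (g - h).
Proof.
move=> [m [n [m0 e]]] [m' [n' [m0' e']]]; exists (m * m'), (n * m' - m * n'); split.
  by rewrite intrM mulf_neq0.
move=> v; have -> : (g - h) v = g v - h v by [].
rewrite intrB !intrM mulrBr mulrBl; congr (_ - _).
  by rewrite mulrAC e mulrAC.
by rewrite -mulrA e' mulrA.
Qed.

(** Induction on the length of the word.  Its first letter can be taken outside
    the line of [a], so that the first step leads to a weight [a + d].  Unless
    [a + d] is on the line of [b], the induction hypothesis applies to the rest
    of the word.  If it is, and if all remaining letters are on that line, they
    are distributed over [x] and the first letter, both outside the line; if
    not, a second letter, outside the line of [b], can be brought forward. *)
Lemma diff_line_reach n a b x s : wvec a x -> Off a -> root_word s ->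
  (size s <= n)%N -> ~ I (word_act x s) -> word_weight a s = b -> Off b ->
  ~ same_line a.1 b.1 -> reach OffKernel a b.
Proof.
elim/ltn_ind: n a b x s => n IHn a b x s wx Oa rs sn nI ew Ob nab.
(* A word leaving the line of [c] can be made to leave it at its first letter. *)
have enter c y t : wvec c y -> Off c -> root_word t -> ~ I (word_act y t) ->
    word_weight c t = b ->
    letters_in (same_line c.1) t \/ exists d D t',
    [/\ wvec d D /\ ~ same_line c.1 d.1, root_word t', (size t' < size t)%N,
      ~ I (word_act (y ** D) t') & word_weight (c + d) t' = b].
  move=> wy Oc rt nIt et.
  case: (letters_split (same_line c.1) t) => [|[t1 [[d D] [t2 [e Qt1 nd]]]]]; first by left.
  right; move: rt nIt; rewrite e => /root_word_cat[rt1 [wD d0 rt2]].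
  rewrite word_act_cat /= => nIt.
  have [d' [D' [t' [wD' rt' le nI' ew']]]] :=
    outer_letter_first (@same_lineB c.1) wy wD rt1 rt2 Qt1 nd nIt.
  exists d', D', t'; split=> //.
    by rewrite size_cat /= addnS ltnS.
  by rewrite ew' -et e word_weight_cat.
have out c d D : Off c -> wvec d D -> ~ same_line c.1 d.1 -> ~ same_line c.1 (c + d).1.
  move=> Oc wD nd ncd; apply: nd.
  have -> : d.1 = (c + d).1 - c.1 by rewrite /= addrAC subrr add0r.
  by apply: same_lineB ncd _; apply: same_line_refl.
have step c d y D : wvec c y -> Off c -> wvec d D -> ~ same_line c.1 d.1 -> ~ I (y ** D) ->
    Off (c + d) /\ reach OffKernel c (c + d).
  move=> wy Oc wD nd nIyD; have Ocd : Off (c + d).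
    apply: (off_weight_intro L_max_length (wvec_br wy wD) _ nIyD) => e.
    by apply: (out c d D) => //; rewrite e; apply: same_line0.
  split=> //; apply: reach1 Ocd.
  apply: (off_weight_intro L_max_length wD _ (notin_kernel_brr nIyD)) => e.
  by apply: nd; rewrite e; apply: same_line0.
case: (enter a x s wx Oa rs nI ew) => [Qs|[d [D [t [[wD nd] rt lt nI' et]]]]].
  case: nab; rewrite -ew; apply: (letters_in_weight (@same_lineB a.1)) => //.
    exact: same_line0.
  exact: same_line_refl.
have [Oad rad] := step _ _ _ _ wx Oa wD nd (notin_kernel_word nI').
have tn := leq_trans lt sn.
have [lb|nlb] := pselect (same_line (a + d).1 b.1); last first.
  apply: reach_trans rad _.
  exact: (IHn (size t) tn _ _ _ _ (wvec_br wx wD) Oad rt (leqnn _) nI' et Ob nlb).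
case: (enter _ _ _ (wvec_br wx wD) Oad rt nI' et) => [Qt|].
  have na : ~ same_line (a + d).1 a.1.
    move=> l; apply: (out _ _ _ Oa wD nd); apply: same_line_sym l.
    exact: is_weight_neq0 Oa.
  have nd' : ~ same_line (a + d).1 d.1.
    move=> l; apply: na; have -> : a.1 = (a + d).1 - d.1 by rewrite /= addrK.
    by apply: same_lineB l; apply: same_line_refl.
  rewrite -et; apply: split_word_reach wx wD rt _ _ _ nI'.
  - exact: (letters_in_avoids (@same_lineB _) (same_line0 _) na Qt).
  - exact: (letters_in_avoids (@same_lineB _) (same_line0 _) nd' Qt).
  - by rewrite et; apply: is_weight_neq0 Ob.
move=> [d' [D' [t' [[wD' nd'] rt' lt' nI'' et']]]].
have [Oadd radd] := step _ _ _ _ (wvec_br wx wD) Oad wD' nd' (notin_kernel_word nI'').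
apply: reach_trans rad _; apply: reach_trans radd _.
apply: (IHn (size t') (ltn_trans lt' tn) _ _ _ _ (wvec_br (wvec_br wx wD) wD') Oadd rt' (leqnn _) nI'' et' Ob).
move=> lb'; apply: (out _ _ _ Oad wD' nd').
apply: same_line_trans lb _; apply: same_line_sym lb'.
exact: is_weight_neq0 Ob.
Qed.

End Lines.

(** * Triples and the odd weights on their line *)

Section RankOne.
Context {K : fieldType} {L : leibnizSuperType K} {H : max_abelian_subalg L}.
Hypothesis L_split : is_split H.
Hypothesis L_max_length : is_maximal_length H.
Hypothesis Z_Lie_0 : lie_annihilator H = [set 0].
Hypothesis L_root_mult : is_root_multiplicative H.
Hypothesis two_neq0 : 2%:~R != 0 :> K.
Hypothesis three_neq0 : 3%:~R != 0 :> K.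
Implicit Types (x y z v X D E : L) (a b c d w : weight H).

Local Notation I := (@lie_kernel K L).
Local Notation Off := (is_weight OffKernel).

Let iI : ideal I := ideal_lie_kernel.
Let sI : subspace I := ideal_subspace ideal_lie_kernel.

(** A copy of sl_2 made of even root vectors; the normalisation [r.1 h = 2] turns
    the root [n * r.1] into the usual integral weight [2 * n]. *)
Definition sl2_triple (r : weight H) (e f : L) (h : even_part H) : Prop :=
  [/\ r.2 = 0, wvec r e, wvec (- r) f, val h = e ** f & r.1 h = 2%:~R].

Lemma fun_mulrz (g : even_part H -> K) (n : int) u : (g *~ n) u = g u *~ n.
Proof.
have nat_case (m : nat) : (g *+ m) u = g u *+ m.
  by elim: m => [|m IHm]; rewrite ?mulr0n // !mulrS fctE IHm.
by case: n => m; rewrite ?NegzE ?mulrNz -?pmulrn ?fctE -nat_case.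
Qed.

Lemma scalar_at0 (g : even_part H -> K) : scalar g -> g 0 = 0.
Proof. by move=> sg; have := sg (-1) 0 0; rewrite scaler0 addr0 /= mulN1r addNr. Qed.

Lemma off_span w x y : Off w -> wvec w x -> ~ I x -> wvec w y -> exists k, y = k *: x.
Proof.
move=> Ow wx nIx; apply: (wvec_line L_max_length (is_weight_neq0 Ow) wx).
exact: notin_kernel_neq0.
Qed.

Lemma off_neq0_notin w x : Off w -> wvec w x -> x <> 0 -> ~ I x.
Proof. by move=> Ow wx x0 Ix; apply: x0; apply: off_weight_kernel0 Ow wx Ix. Qed.

Lemma off_br_notin a b x y : Off a -> Off b -> Off (a + b) ->
  wvec a x -> ~ I x -> wvec b y -> ~ I y -> ~ I (x ** y).
Proof.
move=> Oa Ob Oab wx nx wy ny; apply: (off_neq0_notin Oab (wvec_br wx wy)).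
apply: (off_mult L_max_length L_root_mult Oa Ob (is_weight_root Oab) wx _ wy);
  exact: notin_kernel_neq0.
Qed.

Lemma kernel_skew a b x y : wvec a x -> wvec b y -> I (x ** y) -> I (y ** x).
Proof.
move=> wx wy Ixy; have := wvec_skew wx wy.
rewrite addrC => /(subspace_addIl sI Ixy) /(subspaceZI sI); apply.
by rewrite signr_eq0.
Qed.

Lemma skew_eq a b x y : (a + b).1 = 0 \/ Off (a + b) -> wvec a x -> wvec b y ->
  x ** y = - ((-1) ^+ (a.2 * b.2)%N *: (y ** x)).
Proof.
move=> hab wx wy; apply/eqP; rewrite -addr_eq0; apply/eqP.
apply: (kernel_wvec0 L_split Z_Lie_0 hab _ (wvec_skew wx wy)).
by apply: wvecD; [apply: wvec_br|rewrite addrC; apply: wvecZ; apply: wvec_br].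
Qed.

Lemma sgn11 : (-1) ^+ ((1%R : 'Z_2) * (1%R : 'Z_2))%N = -1 :> K.
Proof. by rewrite /= expr1. Qed.

(** Right multiplication by [x ** x] is zero, and by the Leibniz identity it is
    twice the square of right multiplication by [x]. *)
Lemma odd_sq_act w a x y : a.2 = 1 -> wvec a x -> I (x ** x) -> wvec w y ->
  y ** x ** x = 0.
Proof.
move=> a1 wx Ixx wy; have := kernel_right y Ixx.
rewrite (wvec_leibniz wy wx wx) a1 sgn11 scaleN1r opprK -mulr2n -scaler_nat => /eqP.
by rewrite scaler_eq0 -[2%:R]/(2%:~R) (negPf two_neq0) => /eqP.
Qed.

(* The generator of the kernel attached to [x] and [x] is twice [x ** x]. *)
Lemma even_sq_kernel a x : a.2 = 0 -> wvec a x -> I (x ** x).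
Proof.
move=> a0 wx; have := wvec_skew wx wx; rewrite a0 mul0n scale1r -mulr2n -scaler_nat.
by apply: (subspaceZI sI); rewrite -[2%:R]/(2%:~R).
Qed.

Lemma even_sq_neq0 a x : Off a -> root_set H (a + a).1 -> wvec a x -> ~ I x -> x ** x <> 0.
Proof.
move=> Oa raa wx nIx; have x0 := notin_kernel_neq0 nIx.
exact: (off_mult L_max_length L_root_mult Oa Oa raa wx x0 wx x0).
Qed.

(** The square of an even root vector is in the kernel, and root-multiplicativity
    makes it nonzero when twice the root is a root. *)
Lemma even_double a : Off a -> a.2 = 0 -> ~ Off (a + a).
Proof.
move=> Oa a0 Oaa; have [x wx nIx] := off_weight_ex Oa.
apply: (even_sq_neq0 Oa (is_weight_root Oaa) wx nIx).
exact: off_weight_kernel0 Oaa (wvec_br wx wx) (even_sq_kernel a0 wx).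
Qed.

Section Triple.
Variables (r : weight H) (e f : L) (h : even_part H).
Hypothesis triple : sl2_triple r e f h.

Definition rho (n : int) (i : 'Z_2) : weight H := (r.1 *~ n, i).

Lemma rhoD n i m j : rho n i + rho m j = rho (n + m) (i + j).
Proof. by rewrite /rho mulrzDr. Qed.

Lemma rhoE : r = rho 1 0.
Proof. by rewrite /rho mulr1z; case: triple => <- _ _ _ _; rewrite -surjective_pairing. Qed.

Lemma rhoN n i : - rho n i = rho (- n) i.
Proof.
by rewrite /rho mulrNz; congr (_, _); rewrite /= Z2_opp.
Qed.

Lemma rho_eval n i : (rho n i).1 h = (2 * n)%:~R.
Proof. by rewrite /rho /= fun_mulrz; case: triple => _ _ _ _ ->; rewrite mulrzA. Qed.

Lemma rho_inj_neq n i m j : (n - m)%:~R != 0 :> K -> (rho n i).1 <> (rho m j).1.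
Proof.
move=> nm e1; have := congr1 (fun g => g h) e1; rewrite !rho_eval => /eqP.
by rewrite -subr_eq0 -intrB -mulrBr intrM mulf_eq0 (negPf two_neq0) (negPf nm).
Qed.

Lemma rho_neq0 n i : n%:~R != 0 :> K -> (rho n i).1 <> 0.
Proof. by move=> n0; have := @rho_inj_neq n i 0 0; rewrite subr0 /= mulr0z; apply. Qed.

Lemma e_wvec : wvec (rho 1 0) e. Proof. by rewrite -rhoE; case: triple. Qed.
Lemma f_wvec : wvec (rho (-1) 0) f.
Proof. by rewrite -rhoN -rhoE; case: triple. Qed.

Lemma rho_br n i m j k l x y : wvec (rho n i) x -> wvec (rho m j) y ->
  n + m = k -> i + j = l -> wvec (rho k l) (x ** y).
Proof. by move=> wx wy <- <-; rewrite -rhoD; apply: wvec_br. Qed.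

Lemma triple_h_notin : ~ I (val h).
Proof.
move=> Ih; have [_ [sr _ _] _ _ r2] := triple.
have h0 : h = 0.
  apply: val_inj; apply: (kernel_mas0 Z_Lie_0 Ih); exact: even_part_mem.
have r0 := scalar_at0 sr.
by case/eqP: two_neq0; rewrite -r2 h0 r0.
Qed.

Lemma e_notin : ~ I e.
Proof.
by case: triple => _ _ _ eh _ Ie; apply: triple_h_notin; rewrite eh; apply: (idealMr iI f Ie).
Qed.

Lemma f_notin : ~ I f.
Proof.
case: triple => _ _ _ eh _ If; apply: triple_h_notin; rewrite eh kernel_right //.
exact: (subspace0 sI).
Qed.

Lemma rho_off n i x : n%:~R != 0 :> K -> wvec (rho n i) x -> ~ I x -> Off (rho n i).
Proof. by move=> n0 wx; apply: (off_weight_intro L_max_length wx); apply: rho_neq0. Qed.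

Lemma off_e : Off (rho 1 0).
Proof. by apply: rho_off e_wvec e_notin; rewrite oner_neq0. Qed.

Lemma off_f : Off (rho (-1) 0).
Proof. by apply: rho_off f_wvec f_notin; rewrite mulrNz oppr_eq0 oner_neq0. Qed.

Lemma sl2_fe w x : wvec w x -> x ** f ** e = x ** e ** f - w.1 h *: x.
Proof.
case: triple => r0 we wf eh _ wx; have [_ <- _] := wx.
by rewrite eh (wvec_leibniz wx we wf) r0 mul0n scale1r opprB addrC subrK.
Qed.

Lemma sl2_ef w x : wvec w x -> x ** e ** f = x ** f ** e + w.1 h *: x.
Proof. by move=> wx; rewrite (sl2_fe wx) subrK. Qed.

Lemma rho_fe n i x : wvec (rho n i) x -> x ** f ** e = x ** e ** f - (2 * n)%:~R *: x.
Proof. by move/sl2_fe; rewrite rho_eval. Qed.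

Lemma rho_ef n i x : wvec (rho n i) x -> x ** e ** f = x ** f ** e + (2 * n)%:~R *: x.
Proof. by move/sl2_ef; rewrite rho_eval. Qed.

(** All results on a triple have a mirror image with [e] and [f] exchanged. *)
Lemma triple_opp : sl2_triple (- r) f e (- h).
Proof.
case: triple => r0 we wf eh r2; split=> //=; rewrite ?r0 ?oppr0 ?opprK //.
  have Ief := wvec_skew we wf; rewrite r0 mul0n scale1r in Ief.
  have : e ** f + f ** e = 0.
    apply: (kernel_mas0 Z_Lie_0 Ief); rewrite -eh.
    apply: (subspaceD mas_subspace); first exact: even_part_mem.
    by apply: (wvec0_mas L_split (wvec_br wf we)); rewrite /= addNr.
  by rewrite -eh => /eqP; rewrite addrC addr_eq0 => /eqP ->.
have [sr _ _] := we.
have := sr (-1) h 0; rewrite addr0 scaleN1r.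
rewrite (scalar_at0 sr).
by rewrite /= addr0 mulN1r fctE => ->; rewrite opprK.
Qed.


Lemma not_off_2_0 : ~ Off (rho 2 0).
Proof. by have := even_double off_e erefl; rewrite rhoD addr0. Qed.

Let n1 : 1%:~R != 0 :> K. Proof. by rewrite oner_neq0. Qed.
Let n4 : 4%:~R != 0 :> K. Proof. by have -> : 4%:~R = 2%:~R * 2%:~R :> K by [rewrite -intrM]; rewrite mulf_neq0. Qed.
Let n6 : 6%:~R != 0 :> K. Proof. by have -> : 6%:~R = 2%:~R * 3%:~R :> K by [rewrite -intrM]; rewrite mulf_neq0. Qed.
Let nN (n : int) : n%:~R != 0 :> K -> (- n)%:~R != 0 :> K.
Proof. by rewrite mulrNz oppr_eq0. Qed.

Lemma subspace_addIr (A : set L) x y : subspace A -> A x -> A (x + y) -> A y.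
Proof. by move=> sA Ax; rewrite addrC; apply: subspace_addIl. Qed.

(** When [2 rho] is a root, [e ** e] is a nonzero vector of the kernel, killed by
    [f].  The triple acts on it as on a lowest weight vector of weight 4, and
    applying [e] twice and [f] twice multiplies it by [4 * 10].  Outside
    characteristic 5 this puts the even weight [4 rho] in the kernel. *)
Lemma char5_of_off_4_0 i : Off (rho 2 i) -> Off (rho 4 0) -> 5%:~R = 0 :> K.
Proof.
move=> O2 O4; apply: contrapT => /eqP n5.
have we := e_wvec; have wf := f_wvec.
pose u := e ** e.
have wu : wvec (rho 2 0) u by apply: (rho_br we we); apply/eqP.
have u0 : u <> 0.
  apply: (even_sq_neq0 off_e _ we e_notin).
  by rewrite rhoD; have := is_weight_root O2.
have Iu : I u by apply: even_sq_kernel we.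
have uf : u ** f = 0.
  apply: (off_weight_kernel0 off_e); last exact: (idealMr iI f Iu).
  by apply: (rho_br wu wf); apply/eqP.
have uef : u ** e ** f = 4%:~R *: u by rewrite (rho_ef wu) uf br0l add0r.
have wue : wvec (rho 3 0) (u ** e) by apply: (rho_br wu we); apply/eqP.
have ueef : u ** e ** e ** f = 10%:~R *: (u ** e).
  by rewrite (rho_ef wue) uef brZl -scalerDl -intrD.
have wuee : wvec (rho 4 0) (u ** e ** e) by apply: (rho_br wue we); apply/eqP.
have uee : u ** e ** e = 0.
  by apply: (off_weight_kernel0 O4 wuee); do 2! apply: (idealMr iI e).
have ue : u ** e = 0.
  have := ueef; rewrite uee br0l => /esym/eqP; rewrite scaler_eq0 => /orP[|/eqP //].
  have -> : 10%:~R = 2%:~R * 5%:~R :> K by rewrite -intrM.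
  by rewrite mulf_eq0 (negPf two_neq0) (negPf n5).
have := uef; rewrite ue br0l => /esym/eqP; rewrite scaler_eq0 (negPf n4) => /eqP.
exact: u0.
Qed.

(** The square of [d] has weight [4 rho], so it is in the kernel except perhaps in
    characteristic 5, where [4 rho] is [- rho].  There [d ** d] would be a
    multiple of [f], and the super Jacobi identity for [d], [d], [d] would give
    [d ** f = 0] modulo the kernel.  Then [d] is a lowest weight vector and
    [d ** e ** e ** f] is [10 = 0] times [d ** e], against
    root-multiplicativity. *)
Lemma off_2_1_sq (d : L) : Off (rho (-1) 1) -> wvec (rho 2 1) d -> ~ I d -> I (d ** d).
Proof.
move=> Om wd nd; apply: contrapT => ndd.
have O2 := rho_off two_neq0 wd nd.
have wdd : wvec (rho 4 0) (d ** d) by apply: (rho_br wd wd); apply/eqP.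
have O4 := rho_off n4 wdd ndd.
have n5 := char5_of_off_4_0 O2 O4.
have we := e_wvec; have wf := f_wvec.
(* In characteristic five the weights [4 rho] and [- rho] coincide. *)
have shift n i : rho (n + 5) i = rho n i.
  congr (_, _); apply/funext => u; rewrite !fun_mulrz mulrzDr -[_ *~ 5]mulrzr.
  by rewrite n5 mulr0 addr0.
have wdd' : wvec (rho (-1) 0) (d ** d) by rewrite -(shift (-1)).
have [k ek] := off_span off_f wf f_notin wdd'.
have k0 : k != 0 by apply/eqP => k0; apply: ndd; rewrite ek k0 scale0r; apply: (subspace0 sI).
have Iddd : I (d ** d ** d).
  have e1 : d ** (d ** d) = 2%:~R *: (d ** d ** d).
    by rewrite (wvec_leibniz wd wd wd) sgn11 scaleN1r opprK -mulr2n -scaler_nat.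
  have := wvec_skew wdd wd; rewrite mul0n scale1r e1 -[X in I (X + _)]scale1r -scalerDl.
  by rewrite -[1 + _]/(1%:~R + _) -intrD; apply: (subspaceZI sI).
have Idf : I (d ** f).
  apply: (kernel_skew wf wd); apply: (subspaceZI sI k0); by rewrite -brZl -ek.
have wde : wvec (rho 3 1) (d ** e) by apply: (rho_br wd we); apply/eqP.
have ndef : ~ I (d ** e ** f).
  rewrite (rho_ef wd) => /(subspace_addIr sI (idealMr iI e Idf)) /(subspaceZI sI n4).
  exact: nd.
have nde := notin_kernel_brl ndef.
have wdee : wvec (rho 4 1) (d ** e ** e) by apply: (rho_br wde we); apply/eqP.
have O41 : Off (rho 4 1) by rewrite -(shift (-1)) in Om.
have ndee : ~ I (d ** e ** e).
  by apply: (off_br_notin (rho_off three_neq0 wde nde) off_e _ wde nde we e_notin); rewrite rhoD addr0.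
have wdee' : wvec (rho (-1) 1) (d ** e ** e) by rewrite -(shift (-1)).
apply: (off_br_notin Om off_f _ wdee' ndee wf f_notin).
  rewrite rhoD addr0 -(shift (-1 + -1)).
  exact: (rho_off three_neq0 wde nde).
rewrite (rho_ef wde) (rho_ef wd) brDl brZl -addrA -scalerDl -intrD.
have -> : (2 * 2 + 2 * 3)%:~R = 2%:~R * 5%:~R :> K by rewrite -intrM.
rewrite n5 mulr0 scale0r addr0.
by do 2! apply: (idealMr iI e).
Qed.

(** As [d] acts with square zero and [y ** d] is a multiple of [e], the product
    [e ** d] is zero: [d] is a highest weight vector of weight 4.  It generates a
    five-dimensional module [d], [x], [z], [t], [g] by successive applications
    of [f].  Now [x] acts with square zero too, while [g ** x] is a nonzero
    multiple of [f], so [f ** x] is zero modulo the kernel, and so is [z]. *)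
Lemma off_2_1_excl : Off (rho 2 1) -> Off (rho (-1) 1) -> False.
Proof.
move=> O2 Om; have [d wd nd] := off_weight_ex O2; have [y wy ny] := off_weight_ex Om.
have we := e_wvec; have wf := f_wvec.
have Idd := off_2_1_sq Om wd nd.
have wyd : wvec (rho 1 0) (y ** d) by apply: (rho_br wy wd); apply/eqP.
have nyd : ~ I (y ** d).
  apply: (off_br_notin Om O2 _ wy ny wd nd); rewrite rhoD.
  by have -> : 1 + 1 = 0 :> 'Z_2 by [apply/eqP]; apply: off_e.
have ed : e ** d = 0.
  have [k ek] := off_span off_e wyd nyd we.
  by rewrite ek brZl (odd_sq_act (a := rho 2 1) erefl wd Idd wy) scaler0.
have wde : wvec (rho 3 1) (d ** e) by apply: (rho_br wd we); apply/eqP.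
have Ide : I (d ** e) by apply: (kernel_skew we wd); rewrite ed; apply: (subspace0 sI).
pose x := d ** f; have wx : wvec (rho 1 1) x by apply: (rho_br wd wf); apply/eqP.
pose z := x ** f; have wz : wvec (rho 0 1) z by apply: (rho_br wx wf); apply/eqP.
pose t := z ** f; have wt : wvec (rho (-1) 1) t by apply: (rho_br wz wf); apply/eqP.
pose g := t ** f; have wg : wvec (rho (-2) 1) g by apply: (rho_br wt wf); apply/eqP.
(* Each application of [f] lowers the coefficient of [e] on the string by the
   integral weight of the vector reached. *)
have step (n c : int) v : wvec (rho n 1) (v ** f) -> I (v ** f ** e - c%:~R *: v) ->
    I (v ** f ** f ** e - (c - 2 * n)%:~R *: (v ** f)).
  move=> wv Iv; rewrite (rho_fe wv) intrB scalerBl opprB addrA subrK -brZl -brBl.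
  exact: (idealMr iI f Iv).
have notin (c : int) v : c%:~R != 0 :> K -> ~ I v -> I (v ** f ** e - c%:~R *: v) -> ~ I (v ** f).
  move=> c0 nv Iv Ivf; apply: nv; apply: (subspaceZI sI c0).
  rewrite -[_ *: v]opprK; apply: (subspaceN sI).
  exact: (subspace_addIr sI (idealMr iI e Ivf) Iv).
have Ix : I (x ** e - (-4)%:~R *: d).
  by rewrite (rho_fe wd) mulrNz scaleNr opprK subrK; apply: (idealMr iI f Ide).
have Iz := step _ _ _ wx Ix; have It := step _ _ _ wz Iz; have Ig := step _ _ _ wt It.
have nx := notin _ _ (nN n4) nd Ix.
have nz : ~ I z by apply: notin Iz => //; apply: (nN n6).
have nt : ~ I t by apply: notin It => //; apply: (nN n6).
have ng : ~ I g by apply: notin Ig => //; apply: (nN n4).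
have Ox := rho_off n1 wx nx.
have Ixx : I (x ** x).
  apply: contrapT => nxx; apply: not_off_2_0; apply: (rho_off two_neq0 _ nxx).
  by apply: (rho_br wx wx); apply/eqP.
have Og := rho_off (nN two_neq0) wg ng.
have wgx : wvec (rho (-1) 0) (g ** x) by apply: (rho_br wg wx); apply/eqP.
have ngx : ~ I (g ** x).
  apply: (off_br_notin Og Ox _ wg ng wx nx); rewrite rhoD.
  by have -> : 1 + 1 = 0 :> 'Z_2 by [apply/eqP]; apply: off_f.
have [k ek] := off_span off_f wgx ngx wf.
apply: nz; apply: (kernel_skew wf wx); rewrite ek brZl (odd_sq_act (a := rho 1 1) erefl wx Ixx wg).
by rewrite scaler0; apply: (subspace0 sI).
Qed.

Lemma odd_kernel_2_0 x : wvec (rho 1 1) x -> I (x ** x).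
Proof.
move=> wx; apply: contrapT => nxx; apply: not_off_2_0; apply: (rho_off two_neq0 _ nxx).
by apply: (rho_br wx wx); apply/eqP.
Qed.

Section OddString.
Variable x : L.
Hypothesis wx : wvec (rho 1 1) x.
Hypothesis nx : ~ I x.

Let we := e_wvec.
Let wf := f_wvec.
Let Ox : Off (rho 1 1). Proof. exact: rho_off n1 wx nx. Qed.
Let wz : wvec (rho 0 1) (x ** f). Proof. by apply: (rho_br wx wf); apply/eqP. Qed.

Let Hz : mas_set H (x ** f). Proof. exact: (wvec0_mas L_split wz). Qed.

(* Here [x] is a highest weight vector: with [x ** f] and [x ** f ** f] it spans
   a copy of the adjoint module, whose middle term is in the odd part of H. *)
Section NoTwo.
Hypothesis n21 : ~ Off (rho 2 1).

Let xfe : x ** f ** e = - (2%:~R *: x).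
Proof.
have wxe : wvec (rho 2 1) (x ** e) by apply: (rho_br wx we); apply/eqP.
have Ixe : I (x ** e) by apply: contrapT => /(rho_off two_neq0 wxe).
rewrite (rho_fe wx) (off_weight_kernel0 Ox _ (idealMr iI f Ixe)) ?sub0r //.
by apply: (rho_br wxe wf); apply/eqP.
Qed.

Let z_neq0 : x ** f <> 0.
Proof.
move=> z0; have := xfe; rewrite z0 br0l => /esym/eqP.
rewrite oppr_eq0 scaler_eq0 (negPf two_neq0) => /eqP.
exact: notin_kernel_neq0.
Qed.

Let z_sq w y : wvec w y -> y ** (x ** f) ** (x ** f) = 0.
Proof.
apply: (odd_sq_act (a := rho 0 1) erefl wz).
by rewrite (mas_abelian Hz Hz); apply: (subspace0 sI).
Qed.

Let wt : wvec (rho (-1) 1) (x ** f ** f).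
Proof. by apply: (rho_br wz wf); apply/eqP. Qed.

Let xffe : x ** f ** f ** e = - (2%:~R *: (x ** f)).
Proof. by rewrite (rho_fe wz) mulr0 scale0r subr0 xfe brNl brZl. Qed.

Lemma odd_string_notin : ~ I (x ** f ** f).
Proof.
move=> It; apply: z_neq0; apply: (kernel_mas0 Z_Lie_0 _ Hz).
apply: (subspaceZI sI two_neq0); rewrite -[_ *: _]opprK; apply: (subspaceN sI).
by rewrite -xffe; apply: (idealMr iI e It).
Qed.

Let Ot : Off (rho (-1) 1). Proof. exact: rho_off (nN n1) wt odd_string_notin. Qed.

(** H is abelian, so right multiplication by [x ** f] has square zero.  It maps [e]
    and [f] to nonzero multiples of the vectors of weights [rho] and [- rho],
    which it therefore kills. *)
Lemma odd_string_z n y : n = 1 \/ n = -1 -> wvec (rho n 1) y -> I (x ** f ** y).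
Proof.
move=> hn wy; apply: (kernel_skew wy wz).
suff -> : y ** (x ** f) = 0 by apply: (subspace0 sI).
case: hn wy => -> wy.
  have [k ->] := off_span Ox wx nx wy.
  have ez : e ** (x ** f) = 2%:~R *: x.
    rewrite (skew_eq _ we wz) ?mul0n ?scale1r ?xfe ?opprK //.
    by right; rewrite rhoD; have -> : rho (1 + 0) (0 + 1) = rho 1 1 by congr (_, _); apply/eqP.
  rewrite brZl; have := z_sq we; rewrite ez brZl => /eqP.
  by rewrite scaler_eq0 (negPf two_neq0) => /eqP ->; rewrite scaler0.
have [k ->] := off_span Ot wt odd_string_notin wy.
have fz : f ** (x ** f) = - (x ** f ** f).
  rewrite (skew_eq _ wf wz) ?mul0n ?scale1r //.
  by right; rewrite rhoD; have -> : rho (-1 + 0) (0 + 1) = rho (-1) 1 by congr (_, _); apply/eqP.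
have := z_sq wf; rewrite fz brNl => /eqP; rewrite oppr_eq0 => /eqP e0.
by rewrite brZl e0 scaler0.
Qed.

(* The next application of [f] would be killed by [e]. *)
Lemma odd_string_low : ~ Off (rho (-2) 1).
Proof.
move=> O2; have [g wg ng] := off_weight_ex O2.
have e1 : rho (-2) 1 + rho 1 0 = rho (-1) 1 by rewrite rhoD; congr (_, _); apply/eqP.
have e2 : rho (-1) 1 + rho (-1) 0 = rho (-2) 1 by rewrite rhoD; congr (_, _); apply/eqP.
have nge : ~ I (g ** e).
  by apply: (off_br_notin O2 off_e _ wg ng we e_notin); rewrite e1.
have ntf : ~ I (x ** f ** f ** f).
  by apply: (off_br_notin Ot off_f _ wt odd_string_notin wf f_notin); rewrite e2.
have wtf : wvec (rho (-2) 1) (x ** f ** f ** f) by rewrite -e2; apply: wvec_br.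
have [k ek] := off_span O2 wtf ntf wg.
apply: nge; rewrite ek brZl (rho_fe wt) xffe brNl brZl mulrN1 mulrNz scaleNr opprK addNr.
by rewrite scaler0; apply: (subspace0 sI).
Qed.

(** The word [x], [f], [f] leads from [rho] to [- rho] through H.  A root vector
    [D] multiplied on its right acts on the second [f] or on [x ** f]; the letter
    obtained can then be distributed over [x] and the first [f]. *)
Lemma odd_string_reach d : Off d -> Off (rho (-1) 1 + d) ->
  reach OffKernel (rho 1 1) (rho (-1) 1 + d).
Proof.
move=> Od Otd; have [D wD nD] := off_weight_ex Od.
have nI : ~ I (x ** f ** f ** D).
  exact: (off_br_notin Ot Od Otd wt odd_string_notin wD nD).
have d0 := is_weight_neq0 Od.
have dE n : d.1 = (rho n 0).1 -> d = rho n d.2 by move=> e1; rewrite [LHS]surjective_pairing e1.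
have d1 : d.1 <> (rho 1 0).1.
  move=> e1; apply: (is_weight_neq0 Otd).
  by rewrite (dE _ e1) rhoD.
have dm1 : d.1 <> (rho (-1) 0).1.
  move=> e1; move: Otd; rewrite (dE _ e1) rhoD; case: (Z2_cases d.2) => ->.
    have -> : rho (-1 + -1) (1 + 0) = rho (-2) 1 by congr (_, _); apply/eqP.
    exact: odd_string_low.
  have -> : rho (-1 + -1) (1 + 1) = rho (-1) 0 + rho (-1) 0 by rewrite rhoD; congr (_, _); apply/eqP.
  exact: (even_double off_f).
have d2 : d.1 <> (rho 2 0).1.
  move=> e1; move: Od; rewrite (dE _ e1); case: (Z2_cases d.2) => -> //.
  exact: not_off_2_0.
have r1 i : (rho 1 i).1 <> 0 by apply: rho_neq0.
have rm1 i : (rho (-1) i).1 <> 0 by apply: rho_neq0; apply: nN.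
have rN : (rho (-1) 0).1 = - (rho 1 0).1 by rewrite /rho /= mulrNz.
have r2 : (rho 2 0).1 = (rho 1 0).1 + (rho 1 0).1 by rewrite /rho /= -mulrzDr.
case: (notin_kernel_leibniz wz wf wD (s := [::]) nI) => nI'.
  have := @split_word_reach _ _ _ L_max_length (rho 1 1) (rho (-1) 0)
    [:: (rho (-1) 0 + d, f ** D)] x f wx wf.
  have -> : word_weight (rho 1 1 + rho (-1) 0) [:: (rho (-1) 0 + d, f ** D)] = rho (-1) 1 + d.
    change (rho 1 1 + rho (-1) 0 + (rho (-1) 0 + d) = rho (-1) 1 + d).
    by rewrite addrA !rhoD; congr (_ + _); congr (_, _); apply/eqP.
  apply=> //; last exact: is_weight_neq0 Otd.
  - split=> //; first exact: wvec_br.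
    rewrite /= => e1; apply: d1; apply/eqP; rewrite -subr_eq0 addrC.
    by apply/eqP; rewrite -rN.
  - split; first exact: r1.
    have s1 : (rho 1 1 + (rho (-1) 0 + d)).1 = d.1.
      by rewrite addrA rhoD /= mulr0z add0r.
    by change ((rho 1 1 + (rho (-1) 0 + d)).1 <> 0); rewrite s1.
  - split=> [|/= e1]; first exact: rm1.
    apply: d2; apply/eqP; rewrite -subr_eq0 r2 opprD addrC -addrA; apply/eqP.
    by rewrite -!rN.
have := @split_word_reach _ _ _ L_max_length (rho 1 1) (rho (-1) 0)
  [:: (d, D)] x f wx wf.
have -> : word_weight (rho 1 1 + rho (-1) 0) [:: (d, D)] = rho 0 1 + d.
  change (rho 1 1 + rho (-1) 0 + d = rho 0 1 + d).
  by rewrite !rhoD; congr (_ + _); congr (_, _); apply/eqP.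
move=> R; have {}R : reach OffKernel (rho 1 1) (rho 0 1 + d).
  apply: R => //; last exact: notin_kernel_brl nI'.
  - split=> [|/= e1]; first exact: r1.
    apply: dm1; rewrite rN; apply/eqP; rewrite -addr_eq0 addrC.
    by apply/eqP; exact: e1.
  - split=> [|/= e1]; first exact: rm1.
    by apply: d1; apply/eqP; rewrite -subr_eq0 addrC -rN; apply/eqP.
  - by rewrite /= mulr0z add0r.
have e1 : rho (-1) 1 + d = rho 0 1 + d + rho (-1) 0.
  by rewrite addrAC rhoD; congr (_ + _); congr (_, _); apply/eqP.
by rewrite e1; apply: reach_step R off_f _; rewrite -e1.
Qed.

End NoTwo.

(** Now [- rho] is not an odd weight off the kernel, so [f] sends [x ** f] into
    the kernel.  The product
    [x ** f ** e] is a multiple [k] of [x], and applying [f] gives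
    [k *: (x ** f) = 0], so [k] or [x ** f] is zero.  The product with [x] vanishes
    since [x ** x] is in the kernel. *)
Lemma odd_string_two n i y : Off (rho 2 1) -> n = 1 \/ n = -1 -> wvec (rho n i) y ->
  I (x ** f ** y).
Proof.
move=> O2 hn wy; have nm : ~ Off (rho (-1) 1) by apply: off_2_1_excl O2.
have wzf : wvec (rho (-1) 1) (x ** f ** f) by apply: (rho_br wz wf); apply/eqP.
have Izf : I (x ** f ** f) by apply: contrapT => /(rho_off (nN n1) wzf).
have Ize : I (x ** f ** e).
  have wze : wvec (rho 1 1) (x ** f ** e) by apply: (rho_br wz we); apply/eqP.
  have [k ek] := off_span Ox wx nx wze.
  have Ikz : I (k *: (x ** f)).
    rewrite -brZl -ek (rho_ef wz) mulr0 scale0r addr0.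
    exact: (idealMr iI e Izf).
  have [k0|k0] := eqVneq k 0; first by rewrite ek k0 scale0r; apply: (subspace0 sI).
  by apply: (idealMr iI e); apply: (subspaceZI sI k0).
case: hn wy => -> wy; case: (Z2_cases i) wy => -> wy.
- by have [k ->] := off_span off_e we e_notin wy; rewrite brZr; apply: (subspaceZ _ sI).
- have [k ->] := off_span Ox wx nx wy; rewrite brZr; apply: (subspaceZ _ sI).
  have e1 : x ** (x ** f) = x ** x ** f - x ** f ** x.
    by rewrite (wvec_leibniz wx wx wf) muln0 scale1r.
  have := wvec_skew wz wx; rewrite sgn11 scaleN1r e1 opprB addrA -mulr2n -scaler_nat.
  rewrite addrC => /(subspace_addIr sI (subspaceN sI (idealMr iI f (odd_kernel_2_0 wx)))).
  exact: (subspaceZI sI two_neq0).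
- by have [k ->] := off_span off_f wf f_notin wy; rewrite brZr; apply: (subspaceZ _ sI).
- have Iy : I y by apply: contrapT => /(rho_off (nN n1) wy).
  by rewrite kernel_right //; apply: (subspace0 sI).
Qed.

End OddString.
End Triple.

(** * Reachability in rank one *)

Section Reachability.
Hypothesis H_sum : (H : set L) =
       lin_span (\bigcup_(b in root_set H)
                   bracket_set (root_space b) (root_space (- b))).
Hypothesis L_simple : is_simple L.
(* In rank one the even part of H has dimension one, so that no root vanishes on a
   nonzero element of it. *)
Hypothesis off_eval_neq0 :
  forall (u : even_part H) w, val u <> 0 -> Off w -> w.1 u != 0.

(** Such a product is an even element of H; in rank one its two factors generate a
    copy of sl_2 or, if they are odd, of osp(1|2). *)
Definition nondegenerate w : Prop :=
  Off w /\ exists x y, [/\ wvec w x, wvec (- w) y & x ** y <> 0].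

Lemma nondegenerate_h w x y : wvec w x -> wvec (- w) y -> x ** y <> 0 ->
  exists u : even_part H, val u = x ** y.
Proof.
move=> wx wy _; have wxy := wvec_br wx wy; rewrite subrr in wxy.
apply: even_part_ex; first by apply: (wvec0_mas L_split wxy).
by case: wxy.
Qed.

Lemma mas_notin_kernel u : mas_set H u -> u <> 0 -> ~ I u.
Proof. by move=> Hu u0 Iu; apply: u0; apply: (kernel_mas0 Z_Lie_0 Iu). Qed.

Lemma br_opp_notin w x y : wvec w x -> wvec (- w) y -> x ** y <> 0 -> ~ I (x ** y).
Proof.
move=> wx wy xy0; apply: mas_notin_kernel => //.
by apply: (wvec0_mas L_split (wvec_br wx wy)); rewrite subrr.
Qed.

Lemma nondegenerate_act w x y d z : wvec w x -> wvec (- w) y -> x ** y <> 0 ->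
  Off d -> wvec d z -> ~ I z -> ~ I (x ** y ** z).
Proof.
move=> wx wy xy0 Od wz nz.
have [u eu] := nondegenerate_h wx wy xy0.
have wu : wvec (0 : weight H) (x ** y) by rewrite -(subrr w); apply: wvec_br.
move=> /(kernel_skew wu wz); rewrite -eu; have [_ -> _] := wz.
by move=> /(subspaceZI sI) h; apply: nz; apply: h; apply: off_eval_neq0 => //; rewrite eu.
Qed.

(** The product of the vectors of weights [w] and [- w] acts on a vector of weight
    [d] by a nonzero scalar.  By the Leibniz identity, [d] can be added to [w] or
    to [- w] first. *)
Lemma nondegenerate_reach w d : nondegenerate w -> Off d -> d.1 <> w.1 -> d.1 <> - w.1 ->
  reach OffKernel w d.
Proof.
move=> [Ow [x [y [wx wy xy0]]]] Od n1 n2; have [z wz nz] := off_weight_ex Od.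
have nI := nondegenerate_act wx wy xy0 Od wz nz.
have w0 := is_weight_neq0 Ow; have d0 := is_weight_neq0 Od.
have ed : word_weight (w + - w) [:: (d, z)] = d.
  by change (w - w + d = d); rewrite subrr add0r.
have := @split_word_reach _ _ _ L_max_length w (- w) [:: (d, z)] x y wx wy.
rewrite ed; apply=> //.
  by split=> // e; apply: n2; apply/eqP; rewrite -addr_eq0 addrC; apply/eqP.
split; first by move/eqP; rewrite oppr_eq0 => /eqP.
by move=> e; apply: n1; apply/eqP; rewrite -subr_eq0 addrC; apply/eqP.
Qed.

Lemma triple_nondegenerate r e f h : sl2_triple r e f h -> nondegenerate r.
Proof.
move=> tr; split; first by rewrite (rhoE tr); apply: off_e tr.
have [_ we wf eh _] := tr; exists e, f; split=> // e0.
by apply: (triple_h_notin tr); rewrite eh e0; apply: (subspace0 sI).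
Qed.

(** As in osp(1|2), the squares of the two odd root vectors form a triple up to
    scaling. *)
Lemma odd_nondegenerate_triple w : nondegenerate w -> w.2 = 1 ->
  exists e f h, sl2_triple (w + w) e f h.
Proof.
move=> [Ow [x [y [wx wy xy0]]]] w1.
have [u eu] := nondegenerate_h wx wy xy0.
have u0 : val u <> 0 by rewrite eu.
have k0 := off_eval_neq0 u0 Ow; set k := w.1 u in k0.
have ww0 : (w + w).2 = 0 by rewrite /= Z2_char.
have nw1 : (- w).2 = 1 by rewrite /= w1; apply/eqP.
have xu : x ** val u = k *: x by have [_ -> _] := wx.
have yu : y ** val u = - (k *: y).
  by have [_ -> _] := wy; rewrite /= fctE scaleNr.
have wu : wvec (0 : weight H) (val u) by rewrite eu -(subrr w); apply: wvec_br.
have ux : val u ** x = - (k *: x).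
  have O0 : (0 + w).1 = 0 \/ Off (0 + w) by rewrite add0r; right.
  by rewrite (skew_eq O0 wu wx) mul0n scale1r xu.
have yx : y ** x = val u.
  rewrite (skew_eq _ wy wx) ?nw1 ?w1 ?sgn11 ?scaleN1r ?opprK //.
  by left; rewrite /= addNr.
have xxy : x ** x ** y = (2%:~R * k) *: x.
  rewrite (wvec_leibniz_l wx wx wy) nw1 w1 sgn11 scaleN1r -eu xu ux opprK.
  by rewrite -scalerDl mulr_natl.
have xxyy : x ** x ** (y ** y) = (4%:~R * k) *: val u.
  rewrite (wvec_leibniz (wvec_br wx wx) wy wy) nw1 sgn11 scaleN1r opprK -mulr2n.
  by rewrite xxy brZl -eu -scaler_nat scalerA mulrA -[2%:R]/(2%:~R) -intrM.
have n4 : 4%:~R != 0 :> K.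
  by have -> : 4%:~R = 2%:~R * 2%:~R :> K by [rewrite -intrM]; rewrite mulf_neq0.
pose t := (4%:~R * k ^+ 2)^-1.
exists (x ** x), (t *: (y ** y)), (k^-1 *: u); split=> //.
- exact: wvec_br.
- by apply: wvecZ; rewrite opprD; apply: wvec_br.
- rewrite brZr xxyy scalerA /=; congr (_ *: _).
  have -> : t = (4%:~R * k * k)^-1 by rewrite /t expr2 mulrA.
  by rewrite invfM mulrAC mulVf ?mul1r ?mulf_neq0.
have [sw _ _] := wx; have := sw k^-1 u 0; rewrite addr0 (scalar_at0 sw) addr0 /= => e.
by rewrite fctE e mulVf.
Qed.

Lemma nondegenerate_triple w : nondegenerate w -> exists r e f h, sl2_triple r e f h.
Proof.
move=> nw; case: (Z2_cases w.2) => w2; last first.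
  by have [e [f [h tr]]] := odd_nondegenerate_triple nw w2; exists (w + w), e, f, h.
have [Ow [x [y [wx wy xy0]]]] := nw; have [u eu] := nondegenerate_h wx wy xy0.
have u0 : val u <> 0 by rewrite eu.
have k0 := off_eval_neq0 u0 Ow; set k := w.1 u in k0.
exists w, x, ((2%:~R / k) *: y), ((2%:~R / k) *: u); split=> //.
- exact: wvecZ.
- by rewrite brZr -eu.
have [sw _ _] := wx; have := sw (2%:~R / k) u 0; rewrite addr0 (scalar_at0 sw) addr0 /= => ->.
by rewrite divfK.
Qed.

(** Otherwise H, being spanned by products of opposite root vectors, would have no
    even part, and every root would be zero. *)
Lemma nondegenerate_ex a : Off a -> exists w, nondegenerate w.
Proof.
move=> Oa; have [u au] := root_ne_ex (is_weight_neq0 Oa); apply: contrapT => nex.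
suff u1 : homog 1 (val u).
  have u0 : val u = 0 by apply: homog_both u1; apply: even_part_homog.
  have u00 : u = 0 by apply: val_inj.
  by move: au; rewrite u00 (scalar_at0 (is_weight_scalar Oa)) eqxx.
have := even_part_mem u; rewrite H_sum; apply: (lin_span_le (homog_sub 1)) => v [g rg].
apply: (lin_span_le (homog_sub 1)) => _ [x rx [y ry <-]].
have [sg g0 _] := rg.
have [x0 [x1 [hx0 hx1 e]]] := parity_split x; rewrite e in rx *.
have [rx0 rx1] := @root_space_parity _ _ _ g 0 x0 x1 hx0 ltac:(by rewrite add0r) rx.
have [y0 [y1 [hy0 hy1 e']]] := parity_split y; rewrite e' in ry *.
have [ry0 ry1] := @root_space_parity _ _ _ (- g) 0 y0 y1 hy0 ltac:(by rewrite add0r) ry.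
have null i x' y' : homog i x' -> homog i y' -> root_space g x' -> root_space (- g) y' ->
    x' ** y' = 0.
  move=> hx hy rx' ry'; apply: contrapT => xy0; apply: nex.
  have wx : wvec ((g, i) : weight H) x' by [].
  have wy : wvec (- ((g, i) : weight H)) y'.
    split=> //=; first exact: scalar_funN.
    by rewrite Z2_opp.
  exists (g, i); split; last by exists x', y'.
  apply: (off_weight_intro L_max_length wx g0).
  exact: notin_kernel_brl (br_opp_notin wx wy xy0).
rewrite brDl !brDr (null 0 x0 y0) // (null 1 x1 y1) // add0r addr0.
apply: (subspaceD (homog_sub 1)).
  by rewrite -[1]add0r; apply: bracket_homog.
by rewrite -[1]addr0; apply: bracket_homog.
Qed.

(* Twice an odd nondegenerate weight is an even off-kernel weight. *)
Lemma block_odd_degenerate r e f h n : sl2_triple r e f h -> n = 1 \/ n = -1 ->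
  ~ nondegenerate (rho r n 1).
Proof.
move=> tr hn nw; have [e' [f' [h' tr']]] := odd_nondegenerate_triple nw erefl.
have : Off (rho r n 1 + rho r n 1) by rewrite (rhoE tr'); apply: off_e tr'.
have -> : rho r n 1 + rho r n 1 = rho r n 0 + rho r n 0.
  by rewrite !rhoD; congr (_, _); apply/eqP.
by apply: even_double => //; case: hn => ->; [apply: off_e tr|apply: off_f tr].
Qed.

Lemma reach_first a b : reach OffKernel a b ->
  b = a \/ exists d, [/\ Off d, Off (a + d) & reach OffKernel (a + d) b].
Proof.
elim=> [|c d _ [->|[d' [Od' Oad' r]]] Od Ocd]; first by left.
  by right; exists d; split=> //; apply: reach_refl.
by right; exists d'; split=> //; apply: reach_step r Od Ocd.
Qed.

(** The product [x ** y] is in H and [q] has the root of [a] or its opposite.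
    Since [a + r] and [- r] are weights, [x] is a multiple of [x ** e ** f], and
    the letters [y] and [z] can be distributed over [x ** e] and [f].  The only
    obstruction is [2 a.1 = - r.1]; then [a] or [p], whichever is even, would
    have an even off-kernel double. *)
Lemma jump_off_block r e f h a p q x y z : sl2_triple r e f h ->
  Off a -> wvec a x -> wvec p y -> wvec q z ->
  p.1 = - a.1 -> p.2 <> a.2 -> q.1 = a.1 \/ q.1 = - a.1 ->
  a.1 <> r.1 -> a.1 <> - r.1 -> ~ I (x ** e) -> ~ I (x ** y ** z) ->
  reach OffKernel a (a + p + q).
Proof.
move=> tr Oa wx wy wz ep np eq ar amr nxe nI.
have [r2 we wf _ _] := tr.
have Or : Off r by rewrite (rhoE tr); apply: off_e tr.
have Omr : Off (- r).
  by rewrite (rhoE tr) rhoN; apply: off_f tr.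
have a0 := is_weight_neq0 Oa; have r0 := is_weight_neq0 Or.
have c0 : (a + r).1 <> 0 by move/eqP; rewrite addr_eq0 => /eqP.
have Oc := off_weight_intro L_max_length (wvec_br wx we) c0 nxe.
have nxef : ~ I (x ** e ** f).
  apply: (off_br_notin Oc Omr _ (wvec_br wx we) nxe wf (f_notin tr)).
  by rewrite addrK.
have wxef : wvec a (x ** e ** f) by have := wvec_br (wvec_br wx we) wf; rewrite addrK.
have [k ek] := off_span Oa wxef nxef wx.
have nI' : ~ I (x ** e ** f ** y ** z).
  by move=> J; apply: nI; rewrite ek !brZl; apply: (subspaceZ _ sI).
have Op : Off p.
  apply: (off_weight_intro L_max_length wy); last exact: notin_kernel_brr (notin_kernel_brl nI).
  by rewrite ep => /eqP; rewrite oppr_eq0 => /eqP.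
have q0 : q.1 <> 0 by case: eq => -> // /eqP; rewrite oppr_eq0 => /eqP.
have half : a.1 + a.1 <> - r.1.
  move=> e2; case: (Z2_cases a.2) => a2.
    apply: (even_double Oa a2); have -> // : a + a = - r.
    by rewrite [LHS]surjective_pairing [RHS]surjective_pairing /= e2 a2 r2; congr (_, _); apply/eqP.
  have p2 : p.2 = 0 by case: (Z2_cases p.2) => // p2; case: np; rewrite p2 a2.
  apply: (even_double Op p2); have -> // : p + p = r.
  rewrite [LHS]surjective_pairing [RHS]surjective_pairing /= ep p2 r2 addr0; congr (_, _).
  by rewrite -opprD e2 opprK.
apply: reach_trans (reach1 Or Oc) _.
have := @split_word_reach _ _ _ L_max_length (a + r) (- r) [:: (p, y); (q, z)] (x ** e) f
  (wvec_br wx we) wf.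
have -> : word_weight (a + r + - r) [:: (p, y); (q, z)] = a + p + q.
  by change (a + r - r + p + q = a + p + q); rewrite addrK.
apply=> //.
- by have p0 := is_weight_neq0 Op; split=> //; split.
- apply: avoids2; rewrite ?[X in X.1.1]/= //.
  + rewrite [(a + r).1]/(a.1 + r.1); case: eq => ->; last by rewrite addrAC subrr add0r.
    by move=> E; apply: half; apply/eqP; rewrite -addr_eq0 addrAC; apply/eqP.
  + by rewrite [(a + r).1]/(a.1 + r.1) ep addrAC subrr add0r.
  + rewrite [(a + r).1]/(a.1 + r.1) ep [a.1 + r.1 - a.1]addrAC subrr add0r; case: eq => ->.
      by move/eqP; rewrite addrC addr_eq0 => /eqP.
    by move/eqP; rewrite subr_eq0 => /eqP e1; apply: ar.
- have mr0 : - r.1 <> 0 by move/eqP; rewrite oppr_eq0 => /eqP.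
  apply: avoids2; rewrite ?[X in X.1.1]/= // ?[(- r).1]/(- r.1).
  + rewrite addrC; case: eq => ->; first by move/eqP; rewrite subr_eq0 => /eqP.
    by move/eqP; rewrite -opprD oppr_eq0 addr_eq0 => /eqP.
  + by rewrite ep -opprD => /eqP; rewrite oppr_eq0 addrC addr_eq0 => /eqP.
  + rewrite ep; case: eq => ->; first by rewrite subrK.
    move=> E; apply: half; apply/eqP; rewrite -addr_eq0 -oppr_eq0 !opprD addrC addrA.
    by apply/eqP; exact: E.
- by rewrite /= ep subrr add0r.
Qed.

(* The eigenvalue of [h] on [x] is nonzero, so [e] or [f] does not kill [x]. *)
Lemma triple_raising r e f h a x : sl2_triple r e f h -> Off a -> wvec a x -> ~ I x ->
  exists r' e' f' h', [/\ sl2_triple r' e' f' h', r'.1 = r.1 \/ r'.1 = - r.1 &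
    ~ I (x ** e')].
Proof.
move=> tr Oa wx nx; have [Ie|nIe] := pselect (I (x ** e)); last first.
  by exists r, e, f, h; split=> //; left.
exists (- r), f, e, (- h); split; [exact: triple_opp tr|by right|] => If.
have h0 : val h <> 0.
  by move=> h0; apply: (triple_h_notin tr); rewrite h0; apply: (subspace0 sI).
apply: nx; apply: (subspaceZI sI (off_eval_neq0 h0 Oa)).
apply: (subspace_addIr sI (idealMr iI e If)).
by rewrite -(sl2_ef tr wx); apply: (idealMr iI f Ie).
Qed.

Lemma triple_at r e f h (g : even_part H -> K) : sl2_triple r e f h ->
  g = r.1 \/ g = - r.1 -> exists r' e' f' h', sl2_triple r' e' f' h' /\ r'.1 = g.
Proof.
move=> tr [->|->]; first by exists r, e, f, h.
by exists (- r), f, e, (- h); split=> //; apply: triple_opp tr.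
Qed.

(** Induction on the length of the word.  If the first letter [p] leads to root
    zero, either [a] is nondegenerate or [p] has the other parity, and the next
    letter [q] is considered.  When its root is not the one of [a] up to sign,
    the passage through H is removed by distributing [q].  Outside the block of
    the triple [jump_off_block] applies.  Inside, [a] is the odd weight [rho], and
    the passage ends at [rho], where nothing has moved, or at the odd weight
    [- rho], which is degenerate, so that the chain goes on from there and
    [odd_string_reach] shortcuts it. *)
Lemma word_reach_nondegenerate r e f h m s a x : sl2_triple r e f h ->
  (size s <= m)%N -> wvec a x -> Off a -> root_word s -> ~ I (word_act x s) ->
  nondegenerate (word_weight a s) ->
  exists2 w, nondegenerate w & reach OffKernel a w.
Proof.
move=> tr; elim: m s a x => [|m IHm] [|p s] a x //=.
1,2: by move=> _ _ Oa _ _ na; exists a => //; apply: reach_refl.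
move=> sm wx Oa [wp p0 rs] nI nw.
have nxp := notin_kernel_word nI; have wxp := wvec_br wx wp.
have np := notin_kernel_brr nxp; have Op := off_weight_intro L_max_length wp p0 np.
have [ap0|ap0] := pselect ((a + p.1).1 = 0); last first.
  have Oap := off_weight_intro L_max_length wxp ap0 nxp.
  have [w nw' rw] := IHm s _ _ sm wxp Oap rs nI nw.
  by exists w => //; apply: reach_trans (reach1 Op Oap) rw.
have ep : p.1.1 = - a.1 by apply/eqP; rewrite -addr_eq0 addrC; apply/eqP.
have [p2|p2] := eqVneq p.1.2 a.2.
  exists a; last exact: reach_refl.
  split=> //; exists x, p.2; split=> //; last exact: notin_kernel_neq0.
  have -> // : - a = p.1.
  by rewrite [RHS]surjective_pairing p2 ep -[X in (_, X)]Z2_opp.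
case: s sm rs nI nw => [_ _ _ [On _]|q s sm [wq q0 rs] /= nI nw].
  by have := is_weight_neq0 On.
have nxpq := notin_kernel_word nI; have wxpq := wvec_br wxp wq.
have et : (a + p.1 + q.1).1 = q.1.1 by rewrite -[RHS]add0r -ap0.
have t0 : (a + p.1 + q.1).1 <> 0 by rewrite et.
have Ot := off_weight_intro L_max_length wxpq t0 nxpq.
have nq := notin_kernel_brr nxpq; have Oq := off_weight_intro L_max_length wq q0 nq.
have sm' : (size s <= m)%N by apply: ltnW.
have IH := IHm s _ _ sm' wxpq Ot rs nI nw.
have done_if : reach OffKernel a (a + p.1 + q.1) ->
    exists2 w, nondegenerate w & reach OffKernel a w.
  by case: IH => w nw' rw ra; exists w => //; apply: reach_trans ra rw.
have [eq|/not_orP[nq1 nq2]] := pselect (q.1.1 = a.1 \/ q.1.1 = - a.1); last first.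
  apply: done_if.
  have := @split_word_reach _ _ _ L_max_length a p.1 [:: q] x p.2 wx wp.
  change (word_weight (a + p.1) [:: q]) with (a + p.1 + q.1); apply=> //.
  - have a0 := is_weight_neq0 Oa; split=> /=; first exact: a0.
    by rewrite addrC => /eqP; rewrite addr_eq0 => /eqP.
  - by split=> //=; rewrite ep addrC => /eqP; rewrite subr_eq0 => /eqP.
have [ab|/not_orP[na1 na2]] := pselect (a.1 = r.1 \/ a.1 = - r.1); last first.
  apply: done_if.
  have [r' [e' [f' [h' [tr' er' nxe]]]]] := triple_raising tr Oa wx (notin_kernel_brl nxp).
  apply: (jump_off_block tr' Oa wx wp wq ep _ eq _ _ nxe nxpq); first exact/eqP.
    by case: er' => ->.
  by case: er' => ->; rewrite ?opprK.
have [r' [e' [f' [h' [tr' er']]]]] := triple_at tr ab.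
have r'2 : r'.2 = 0 by case: tr'.
have ea : a = rho r' 1 a.2 by rewrite [LHS]surjective_pairing /rho mulr1z er'.
case: (Z2_cases a.2) => a2.
  have -> : a = r' by rewrite ea a2 [RHS]surjective_pairing r'2 /rho mulr1z.
  by exists r'; [apply: triple_nondegenerate tr'|apply: reach_refl].
rewrite a2 in ea.
have ep' : p.1 = rho r' (-1) 0.
  rewrite [LHS]surjective_pairing /rho mulrN1z er' ep; congr (_, _).
  by case: (Z2_cases p.1.2) => // p21; rewrite p21 a2 in p2.
have [n [hn eq']] : exists n : int, (n = 1 \/ n = -1) /\ q.1 = rho r' n q.1.2.
  case: eq => eq; [exists 1|exists (-1)]; split; [by left| |by right|].
    by rewrite [LHS]surjective_pairing /rho mulr1z er' eq.
  by rewrite [LHS]surjective_pairing /rho mulrN1z er' eq.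
rewrite ea in wx; rewrite ep' in wp; rewrite eq' in wq.
have nx := notin_kernel_brl nxp.
have wf' := f_wvec tr'.
have [k ek] := off_span (off_f tr') wf' (f_notin tr') wp.
have nxfq : ~ I (x ** f' ** q.2).
  by move=> J; apply: nxpq; rewrite ek brZr brZl; apply: (subspaceZ _ sI).
have [O2|nO2] := pselect (Off (rho r' 2 1)).
  by case: nxfq; apply: (odd_string_two tr' wx nx O2 hn wq).
case: (Z2_cases q.1.2) => q2; rewrite q2 in eq' wq; last first.
  by case: nxfq; apply: (odd_string_z tr' wx nx nO2 hn wq).
have et' : a + p.1 + q.1 = rho r' n 1.
  rewrite ea ep' eq' !rhoD; congr (_, _); last by apply/eqP.
  by rewrite subrr add0r.
case: hn => hn; rewrite hn in et'.
  by apply: done_if; rewrite et' ea; apply: reach_refl.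
case: IH => w nw'; rewrite et' => /reach_first[ew|[d [Od Otd rd]]].
  by case: (block_odd_degenerate tr' (or_intror (erefl (-1)))); rewrite -ew.
exists w => //; rewrite ea.
apply: reach_trans rd; exact: (odd_string_reach tr' wx nx nO2 Od Otd).
Qed.

Lemma reach_last a b : reach OffKernel a b ->
  b = a \/ exists c d, [/\ reach OffKernel a c, Off d & b = c + d].
Proof. by case=> [|c d ac Od _]; [left|right; exists c, d]. Qed.

(* Since [r] is even, the other possibility for [b] is the odd weight [2 r], and
   then [c] is the odd weight [- r]. *)
Lemma no_double_step r e f h b c : sl2_triple r e f h -> Off b -> Off c ->
  r = b + c -> b.1 <> r.1 + r.1.
Proof.
move=> tr Ob Oc er eb; have r2 : r.2 = 0 by case: tr.
have eb' : b = rho r 2 b.2 by rewrite [LHS]surjective_pairing eb.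
have ec : c = rho r (-1) c.2.
  rewrite [LHS]surjective_pairing /rho mulrN1z; congr (_, _).
  have -> : c.1 = r.1 - b.1 by rewrite er /= addrC addKr.
  by rewrite eb opprD addrA subrr add0r.
have e2 : b.2 + c.2 = 0 by rewrite -r2 er.
case: (Z2_cases b.2) => b2; rewrite b2 in eb' e2.
  by apply: (not_off_2_0 tr); rewrite -eb'.
have c2 : c.2 = 1 by apply/eqP; move/eqP: e2; case: (Z2_cases c.2) => ->.
by apply: (off_2_1_excl tr); rewrite -?eb' // -c2 -ec.
Qed.

(** From [a] a nondegenerate weight [w] is reached, and from [w] every weight
    outside its block, possibly through [r].  There remains the case where [b] and
    [w] are in the block of the triple and [a] is not.  Then [w] is [r] or [- r],
    and the last step of the chain to [w], from [y] by [d], is replaced: the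
    element [h] multiplies the root vector of [b] by a nonzero scalar, and the
    word [Y], [D], [f], [B] leads from [y] to [b] when [f] and [B] are distributed
    over [Y] and [D]. *)
Lemma rank_one_reach a b : Off a -> Off b -> b.1 <> a.1 -> b.1 <> - a.1 ->
  reach OffKernel a b.
Proof.
move=> Oa Ob nba nbma; have [w0 nw0] := nondegenerate_ex Oa.
have [r [e [f [h tr]]]] := nondegenerate_triple nw0.
have [x wx nx] := off_weight_ex Oa.
have [s [rs es nI]] := off_word_ex L_split H_sum L_simple wx nx nw0.1.
have [|w nw raw] := word_reach_nondegenerate tr (leqnn _) wx Oa rs nI; first by rewrite es.
have nr := triple_nondegenerate tr.
have [bb|/not_orP[nb1 nb2]] := pselect (b.1 = r.1 \/ b.1 = - r.1); last first.
  have [wb|/not_orP[nw1 nw2]] := pselect (w.1 = r.1 \/ w.1 = - r.1).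
    apply: reach_trans raw _; apply: nondegenerate_reach => //.
      by case: wb => ->.
    by case: wb => ->; rewrite ?opprK.
  apply: reach_trans raw _; apply: (reach_trans (b := r)).
    apply: nondegenerate_reach => //; first exact: nr.1.
      by move=> e1; apply: nw1.
    by move=> e1; apply: nw2; rewrite e1 opprK.
  exact: nondegenerate_reach.
have na : a.1 <> r.1 /\ a.1 <> - r.1.
  case: bb => eb; rewrite eb in nba nbma; split=> e1.
  - by apply: nba.
  - by apply: nbma; rewrite e1 opprK.
  - by apply: nbma; rewrite e1.
  - by apply: nba.
have [wb|/not_orP[nw1 nw2]] := pselect (w.1 = r.1 \/ w.1 = - r.1); last first.
  apply: reach_trans raw _; apply: nondegenerate_reach => // e1.
    by case: bb => eb; [apply: nw1|apply: nw2]; rewrite -e1.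
  have ew : w.1 = - b.1 by rewrite e1 opprK.
  by case: bb => eb; [apply: nw2|apply: nw1]; rewrite ew eb ?opprK.
have [r' [e' [f' [h' [tr' er']]]]] := triple_at tr wb.
have r'2 : r'.2 = 0 by case: tr'.
have ew : w = r'.
  case: (Z2_cases w.2) => w2; first by rewrite [LHS]surjective_pairing [RHS]surjective_pairing er' w2 r'2.
  case: (block_odd_degenerate tr' (or_introl (erefl 1))); rewrite /rho mulr1z er' -w2.
  by rewrite -surjective_pairing.
have {}bb : b.1 = r'.1 \/ b.1 = - r'.1.
  by rewrite er'; case: bb wb => -> [] ->; rewrite ?opprK; auto.
rewrite ew in raw; case: (reach_last raw) => [E|[y [d [ray Od Ed]]]].
  by case: wb => e1; [case: na.1|case: na.2]; rewrite -E er' e1.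
have Oy := reach_weight Oa ray; apply: reach_trans ray _.
have [Y wY nY] := off_weight_ex Oy; have [D wD nD] := off_weight_ex Od.
have [B wB nB] := off_weight_ex Ob.
have Or' : Off (y + d) by rewrite -Ed (rhoE tr'); apply: off_e tr'.
have nYD := off_br_notin Oy Od Or' wY nY wD nD.
have [_ we' wf' eh' _] := tr'.
have wYD := wvec_br wY wD; have we2 := we'; rewrite Ed in we2.
have [k ek] := off_span Or' wYD nYD we2.
have ef0 : e' ** f' <> 0.
  by move=> E; apply: (triple_h_notin tr'); rewrite eh' E; apply: (subspace0 sI).
have nI4 : ~ I (Y ** D ** f' ** B).
  have := nondegenerate_act we' wf' ef0 Ob wB nB.
  by rewrite ek !brZl => J1 J2; apply: J1; apply: (subspaceZ _ sI).
have y0 := is_weight_neq0 Oy; have d0 := is_weight_neq0 Od.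
have b0 := is_weight_neq0 Ob.
have edy : d.1 = r'.1 - y.1 by rewrite Ed /= addrC addKr.
have yr : y.1 <> r'.1 by move=> E; apply: d0; rewrite edy E subrr.
have y2r := no_double_step tr' Oy Od Ed.
have ymr : y.1 <> - r'.1.
  move=> E; apply: (no_double_step tr' Od Oy); first by rewrite addrC.
  by rewrite edy E opprK.
have r'0 : r'.1 <> 0 by rewrite Ed; apply: is_weight_neq0 Or'.
have := @split_word_reach _ _ _ L_max_length y d [:: (- r', f'); (b, B)] Y D wY wD.
have -> : word_weight (y + d) [:: (- r', f'); (b, B)] = b.
  by change (y + d - r' + b = b); rewrite -Ed subrr add0r.
apply=> //.
- have mr0 : (- r').1 <> 0 by move/eqP; rewrite oppr_eq0 => /eqP.
  by split=> //; split.
- apply: avoids2; rewrite //= ?[(- r').1]/(- r'.1).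
  + case: bb => -> /eqP; first by rewrite addr_eq0 => /eqP.
    by rewrite subr_eq0 => /eqP.
  + by move/eqP; rewrite subr_eq0 => /eqP.
  + case: bb => ->; first by rewrite subrK.
    by move/eqP; rewrite subr_eq0 subr_eq => /eqP.
- apply: avoids2; rewrite //= ?[(- r').1]/(- r'.1) edy.
  + case: bb => ->; last by rewrite addrAC subrr add0r => /eqP; rewrite oppr_eq0 => /eqP.
    by move/eqP; rewrite addrAC subr_eq0 => /eqP E; apply: y2r.
  + by rewrite addrAC subrr add0r => /eqP; rewrite oppr_eq0 => /eqP.
  + rewrite [r'.1 - y.1 - r'.1]addrAC subrr add0r; case: bb => ->.
      by move/eqP; rewrite addrC subr_eq0 => /eqP E; apply: yr.
    by move/eqP; rewrite -opprD oppr_eq0 addr_eq0 => /eqP.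
Qed.

End Reachability.
End RankOne.

(** * Simple superalgebras have connected roots *)

Section SimpleConnected.
Context {K : fieldType} {L : leibnizSuperType K} {H : max_abelian_subalg L}.
Hypothesis L_split : is_split H.
Hypothesis L_max_length : is_maximal_length H.
Hypothesis H_sum : (H : set L) =
       lin_span (\bigcup_(b in root_set H)
                   bracket_set (root_space b) (root_space (- b))).
Hypothesis Z_Lie_0 : lie_annihilator H = [set 0].
Hypothesis L_root_mult : is_root_multiplicative H.
Hypothesis L_simple : is_simple L.
Implicit Types (x y : L) (a b c d w : weight H).

Local Notation I := (@lie_kernel K L).
Local Notation Off := (is_weight OffKernel).

Lemma off_diff_line_reach a b : Off a -> Off b -> ~ same_line a.1 b.1 ->
  reach OffKernel a b.
Proof.
move=> Oa Ob nl; have [x wx nx] := off_weight_ex Oa.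
have [s [rs es nI]] := off_word_ex L_split H_sum L_simple wx nx Ob.
exact: (diff_line_reach L_max_length wx Oa rs (leqnn _) nI es Ob nl).
Qed.

Lemma intK_char2 : 2%:~R = 0 :> K -> forall m : int, m%:~R = 0 :> K \/ m%:~R = 1 :> K.
Proof.
move=> c2; have e2 : 1 + 1 = 0 :> K.
  by rewrite -[1 + 1]/(1%:~R + 1%:~R) -intrD c2.
have c1 : -1 = 1 :> K by apply/eqP; rewrite eq_sym -addr_eq0 e2.
elim/int_rec => [|n IHn|n IHn]; first by left.
  rewrite -addn1 PoszD intrD mulr1z.
  by case: IHn => ->; [right; rewrite add0r|left].
rewrite -addn1 PoszD opprD intrD mulrN1z c1.
by case: IHn => ->; [right; rewrite add0r|left].
Qed.

Lemma intK_char3 : 3%:~R = 0 :> K ->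
  forall m : int, [\/ m%:~R = 0 :> K, m%:~R = 1 :> K | m%:~R = -1 :> K].
Proof.
move=> c3; have e2 : 1 + 1 = -1 :> K.
  by apply/eqP; rewrite -addr_eq0 -[1 + 1 + 1]/(1%:~R + 1%:~R + 1%:~R) -!intrD c3.
have e2' : -1 - 1 = 1 :> K by rewrite -opprD e2 opprK.
elim/int_rec => [|n IHn|n IHn]; first by apply: Or31.
  rewrite -addn1 PoszD intrD mulr1z; case: IHn => ->.
  - by apply: Or32; rewrite add0r.
  - by apply: Or33.
  - by apply: Or31; rewrite addNr.
rewrite -addn1 PoszD opprD intrD mulrN1z; case: IHn => ->.
- by apply: Or33; rewrite add0r.
- by apply: Or31; rewrite addrN.
- by apply: Or32.
Qed.

(** The prime field has no elements besides 0, 1 and -1 in characteristics 2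
    and 3. *)
Lemma same_line_char (f g : even_part H -> K) : same_line f g -> g <> 0 ->
  g <> f -> g <> - f -> 2%:~R != 0 :> K /\ 3%:~R != 0 :> K.
Proof.
move=> [m [n [m0 e]]] g0 gf gnf; split; apply/eqP => ch.
  have m1 : m%:~R = 1 :> K by case: (intK_char2 ch m) => // /eqP; rewrite (negPf m0).
  case: (intK_char2 ch n) => n1; [apply: g0|apply: gf]; apply/funext => u;
    have := e u; rewrite m1 n1 ?mul1r ?mul0r //.
have sub : (forall u, g u = 0) \/ (forall u, g u = f u) \/ (forall u, g u = - f u).
  have [m1|m1] : m%:~R = 1 :> K \/ m%:~R = -1 :> K.
    by case: (intK_char3 ch m) => m1; [move: m0; rewrite m1 eqxx|left|right].
    case: (intK_char3 ch n) => n1; [left|right; left|right; right] => u;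
      by have := e u; rewrite m1 n1 ?mul1r ?mul0r ?mulN1r.
  case: (intK_char3 ch n) => n1; [left|right; right|right; left] => u;
    have := e u; rewrite m1 n1 ?mul1r ?mul0r ?mulN1r => /eqP.
  - by rewrite oppr_eq0 => /eqP.
  - by rewrite eqr_oppLR => /eqP.
  - by rewrite eqr_opp => /eqP.
case: sub => [h|[h|h]]; [apply: g0|apply: gf|apply: gnf]; exact/funext.
Qed.

(** If one root vanishes at [u], so do all roots on its line, hence all
    off-kernel roots, and [u] lies in the Lie annihilator. *)
Lemma line_eval_neq0 a (u : even_part H) w : (forall d, Off d -> same_line a.1 d.1) ->
  val u <> 0 -> Off w -> w.1 u != 0.
Proof.
move=> hl u0 Ow; apply/eqP => wu0; apply: u0; suff : [set 0] (val u) by [].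
have d0 d : Off d -> d.1 u = 0.
  move=> Od; have [m [n [m0 e]]] :=
    same_line_trans (same_line_sym (is_weight_neq0 Ow) (hl _ Ow)) (hl _ Od).
  by have := e u; rewrite wu0 mulr0 => /eqP; rewrite mulf_eq0 (negPf m0) => /eqP.
rewrite -Z_Lie_0; apply: lie_annihilator_intro => d y rd nd wy.
have d1 : d.1 <> 0 by case: rd.
have kill v : wvec d v -> I v -> v = 0.
  move=> wv Iv; apply: contrapT => v0; apply: nd.
  exact: weight_roots_kind (in_weight_intro wv d1 Iv v0).
have yu : y ** val u = 0.
  have [_ -> _] := wy; have [Iy|nIy] := pselect (I y); first by rewrite (kill _ wy Iy) scaler0.
  by rewrite (d0 _ (off_weight_intro L_max_length wy d1 nIy)) scale0r.
split=> //; have wu : wvec ((0, 0) : weight H) (val u).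
  by apply: mas_wvec; [apply: even_part_mem|apply: even_part_homog].
apply: kill; first by have := wvec_br wu wy; rewrite add0r.
apply: (kernel_skew wy wu); rewrite yu.
exact: subspace0 (ideal_subspace ideal_lie_kernel).
Qed.

Lemma off_reach a b : Off a -> Off b -> b.1 <> a.1 -> b.1 <> - a.1 -> reach OffKernel a b.
Proof.
move=> Oa Ob n1 n2.
have [lab|nlab] := pselect (same_line a.1 b.1); last exact: off_diff_line_reach.
have [[c [Oc nlac]]|all_line] := pselect (exists c, Off c /\ ~ same_line a.1 c.1).
  apply: reach_trans (off_diff_line_reach Oa Oc nlac) _.
  apply: off_diff_line_reach => // lcb; apply: nlac; apply: same_line_trans lab _.
  exact: same_line_sym (is_weight_neq0 Ob) lcb.
have hl d : Off d -> same_line a.1 d.1.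
  by move=> Od; apply: contrapT => nl; apply: all_line; exists d.
have [two three] := same_line_char lab (is_weight_neq0 Ob) n1 n2.
apply: (rank_one_reach L_split L_max_length Z_Lie_0 L_root_mult two three H_sum L_simple) => //.
by move=> u w; apply: line_eval_neq0 hl.
Qed.

Lemma simple_connected_off : all_offK_connected H OffKernel.
Proof.
move=> i j f g Oa Ob.
have [|/not_orP[n1 n2]] := pselect (g = f \/ g = - f); first by left.
exact: reach_connected (off_reach (a := (f, i)) (b := (g, j)) Oa Ob n1 n2).
Qed.

End SimpleConnected.

Theorem theorem3p1 (K : fieldType) (L : leibnizSuperType K)
    (H : max_abelian_subalg L)
    (L_split : is_split H)
    (L_max_length : is_maximal_length H)
    (H_sum : (H : set L) =
       lin_span (\bigcup_(b in root_set H)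
                   bracket_set (root_space b) (root_space (- b))))
    (Z_Lie_0 : lie_annihilator H = [set 0])
    (L_root_mult : is_root_multiplicative H)
    (card_off : `I_3 #<= roots_kind H OffKernel)
    (card_in : `I_3 #<= roots_kind H InKernel) :
  is_simple L <-> (all_offK_connected H InKernel /\ all_offK_connected H OffKernel).
Proof.
split=> [simp|[conn_in conn_off]]; last exact: connected_simple.
by split; [apply: simple_connected_in|apply: simple_connected_off].
Qed.
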